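(* Let $K$ be a finite set with $|K|\ge 2$. For each $L\in\{1,2,\dots\}\cup\{\infty\}$ and all information structures $u,v\in\mathcal U(L)$, $$\sup_{g\in\mathcal G}\big(\mathrm{val}(v,g)-\mathrm{val}(u,g)\big)=\min_{q_1,q_2\in\mathcal Q(L)}\|q_1.u-v.q_2\| .$$ Hence $$d(u,v)=\max\Big\{\min_{q_1,q_2\in\mathcal Q(L)}\|q_1.u-v.q_2\|,\ \min_{q_1,q_2\in\mathcal Q(L)}\|u.q_1-q_2.v\|\Big\}.$$ If $L<\infty$, the supremum $\sup_{g\in\mathcal G}(\mathrm{val}(v,g)-\mathrm{val}(u,g))$ is attained by some $g\in\mathcal G(L)$.
   Context: $\mathbb N$ is the set of nonnegative integers. An information structure is a probability $u\in\Delta(K\times\mathbb N\times\mathbb N)$ on triples $(k,c,d)$; $k$ is the state, $c$ the signal of player 1 (maximizer), $d$ the signal of player 2 (minimizer). $\mathcal U=\mathcal U(\infty)$ is the set of all information structures; for $1\le L<\infty$, $\mathcal U(L)$ is the set of those for which both signals are $\le L-1$ with probability 1. $\|u-v\|=\sum_{k,c,d}|u(k,c,d)-v(k,c,d)|$. A payoff function is a map $g:K\times I\times J\to[-1,1]$ with $I,J$ finite nonempty sets. $\mathcal G(L)$ is the set of payoff functions with action sets of cardinality $\le L$, and $\mathcal G=\bigcup_{1\le L<\infty}\mathcal G(L)$. $\mathrm{val}(u,g)$ is the value of the zero-sum Bayesian game in which $(k,c,d)$ is drawn from $u$, player 1 learns $c$, player 2 learns $d$, they simultaneously choose $i\in I$,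 $j\in J$ (mixed actions depending on own signal allowed), and player 1 receives $g(k,i,j)$ from player 2. $d(u,v)=\sup_{g\in\mathcal G}|\mathrm{val}(u,g)-\mathrm{val}(v,g)|$. A garbling is a map $q:\mathbb N\to\Delta(\mathbb N)$; $\mathcal Q=\mathcal Q(\infty)$ is the set of garblings and, for $L<\infty$, $\mathcal Q(L)$ is the set of maps $q:\mathbb N\to\Delta(\{0,\dots,L-1\})$. For $q\in\mathcal Q$ and $u\in\mathcal U$: $q.u(k,c,d)=\sum_{c'}u(k,c',d)\,q(c|c')$ and $u.q(k,c,d)=\sum_{d'}u(k,c,d')\,q(d|d')$. *)

(* Defs.v *)
From HB Require Import structures.
From mathcomp Require Import all_boot all_order all_algebra.
From mathcomp Require Import all_classical all_reals ereal esum.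

Set Implicit Arguments.
Unset Strict Implicit.
Unset Printing Implicit Defensive.

Import Order.TTheory GRing.Theory Num.Theory.
Local Open Scope classical_set_scope.
Local Open Scope ring_scope.

(* All infinite sums below have nonnegative terms: [\esum] is then the usual
   countable sum in [0, +oo], and [fine] loses nothing, the sums being finite. *)

(* Probabilities on T with (countably supported) mass function [mass]. *)
Record distr (R : realType) (T : choiceType) := Distr {
  mass :> T -> R;
  mass_ge0 : forall x, 0 <= mass x;
  mass_sum1 : \esum_(x in [set: T]) (mass x)%:E = 1%:E }.

Definition almost_surely_in (R : realType) (T : choiceType)
    (p : distr R T) (A : set T) : Prop :=
  \esum_(x in A) (p x)%:E = 1%:E.

(* {0, ..., L-1}, or all of nat when L = None, which stands for L = infinity. *)
Definition signals (L : option nat) : set nat :=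
  [set n | if L is Some l then (n < l)%N else true].

(* Triples (k, c, d): state, signal of player 1, signal of player 2. *)
Definition info_structure (R : realType) (K : finType) :=
  distr R (K * nat * nat)%type.

Definition info_bounded (R : realType) (K : finType) (L : option nat) :
    set (info_structure R K) :=
  [set u | almost_surely_in u [set x | signals L x.1.2 /\ signals L x.2]].

Definition l1dist (R : realType) (K : finType) (a b : K * nat * nat -> R) : R :=
  fine (\esum_(x in [set: (K * nat * nat)%type]) `|a x - b x|%:E).

Definition garbling (R : realType) := nat -> distr R nat.

Definition garbling_bounded (R : realType) (L : option nat) :
    set (garbling R) :=
  [set q | forall n, almost_surely_in (q n) (signals L)].

(* q.u *)
Definition garble1 (R : realType) (K : finType) (q : garbling R)
    (u : info_structure R K) : K * nat * nat -> R :=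
  fun x => let: (k, c, d) := x in
    fine (\esum_(c' in [set: nat]) (u (k, c', d) * q c' c)%:E).

(* u.q *)
Definition garble2 (R : realType) (K : finType) (u : info_structure R K)
    (q : garbling R) : K * nat * nat -> R :=
  fun x => let: (k, c, d) := x in
    fine (\esum_(d' in [set: nat]) (u (k, c, d') * q d' d)%:E).

(* The type [payoff R K] itself is the set of all payoff functions; the
   nonempty finite action sets I and J are part of the data.  Its universe is
   too large for [set (payoff R K)], hence the suprema over
   [set x | exists g, ...] below. *)
Record payoff (R : realType) (K : finType) := Payoff {
  act1 : finType;
  act2 : finType;
  act1_gt0 : (0 < #|act1|)%N;
  act2_gt0 : (0 < #|act2|)%N;
  pay :> K -> act1 -> act2 -> R;
  pay_bounded : forall k i j, -1 <= pay k i j <= 1 }.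

Definition payoff_bounded (R : realType) (K : finType) (l : nat)
    (g : payoff R K) : Prop :=
  (#|act1 g| <= l)%N /\ (#|act2 g| <= l)%N.

Section BayesianGame.
Context (R : realType) (K : finType) (u : info_structure R K) (g : payoff R K).

Definition strategy1 := nat -> distr R (act1 g).
Definition strategy2 := nat -> distr R (act2 g).

(* Probability that the state is k and the actions played are i and j. *)
Definition play_prob (s : strategy1) (t : strategy2)
    (k : K) (i : act1 g) (j : act2 g) : R :=
  fine (\esum_(y in [set: (nat * nat)%type])
    (u (k, y.1, y.2) * s y.1 i * t y.2 j)%:E).

Definition expected_payoff (s : strategy1) (t : strategy2) : R :=
  \sum_(k : K) \sum_(i : act1 g) \sum_(j : act2 g)
    play_prob s t k i j * g k i j.

Definition is_value (x : R) : Prop :=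
  x = sup [set inf [set expected_payoff s t | t in [set: strategy2]]
          | s in [set: strategy1]] /\
  x = inf [set sup [set expected_payoff s t | s in [set: strategy1]]
          | t in [set: strategy2]].

(* The common value of sup inf and inf sup (0 would be returned, were the two
   different). *)
Definition game_value : R := xget 0 [set x | is_value x].

End BayesianGame.

Definition is_min (R : realType) (A : set R) (m : R) : Prop :=
  A m /\ lbound A m.

Definition sup_gap (R : realType) (K : finType) (v u : info_structure R K) : R :=
  sup [set x | exists g : payoff R K, x = game_value v g - game_value u g].

Definition value_dist (R : realType) (K : finType) (u v : info_structure R K) :
    R :=
  sup [set x | exists g : payoff R K, x = `|game_value u g - game_value v g|].

(* Main.v *)
Require Import Defs.
From HB Require Import structures.
From mathcomp Require Import all_boot all_order all_algebra.
From mathcomp Require Import all_classical all_reals ereal esum.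
From mathcomp Require Import topology normedtype sequences.
From mathcomp Require Import lra ring.

Set Implicit Arguments.
Unset Strict Implicit.
Unset Printing Implicit Defensive.

Import Order.TTheory GRing.Theory Num.Theory.
Import numFieldNormedType.Exports.
Local Open Scope classical_set_scope.
Local Open Scope ring_scope.

(** Why the theorem holds.

    Easy inequality.  Garbling the signal of player 1 can only hurt him, and
    garbling the signal of player 2 can only help him: a strategy played on a
    garbled signal is a strategy on the original one.  As payoffs lie in
    [-1, 1], val(v, g) <= val(v.q2, g) <= val(q1.u, g) + ||q1.u - v.q2||
    <= val(u, g) + ||q1.u - v.q2|| for all g, q1 and q2
    ([game_value_gap_le]).

    Finitely many signals.  ||q1.u - v.q2|| is the maximum, over the payoffs g
    whose actions are the signals themselves, of the difference <g, v.q2> -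
    <g, q1.u>, which is bilinear in g and (q1, q2).  A saddle point of this
    form provides garblings q1, q2 and a payoff g.  In v, player 1 can announce
    his signal truthfully and get at least the minimum over q2 of <g, v.q2>; in
    u, the truthful player 2 concedes at most the maximum over q1 of
    <g, q1.u>.  So val(v, g) - val(u, g) is at least the saddle value, which is
    ||q1.u - v.q2|| ([finite_duality]); hence g attains the supremum and
    (q1, q2) the minimum.

    The minimax theorem that produces saddle points is [saddle_point], for
    bilinear forms on products of simplices; it comes from Farkas' lemma.  It
    also gives the existence of the value of games with finitely many signals,
    and every information structure is within any e > 0, in l1 distance,
    of one with finitely many signals ([truncate_close]), so that all values
    exist ([lower_eq_upper_value]).

    Infinitely many signals.  The finite case applied to truncations of u and v
    gives garblings with ||q1.u - v.q2|| as close as desired to the supremum of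
    the gaps.  It remains to see that the minimum is attained although
    garblings on the set of all integers are not compact, as mass can escape to
    infinity ([garbling_limit]).  Since ||a - b|| = 2 - 2 sum min(a, b) for
    probabilities a and b, and since, when u and v have signals below n, only
    pairs of signals below n contribute to this sum, the norm is a continuous
    function of finitely many entries of (q1, q2), and it decreases with these
    entries.  So a limit of the entries of (q1, q2) along an ultrafilter does
    not increase the norm, and neither does any reallocation of the escaped
    mass that turns this limit into garblings. *)

(** * Sums of nonnegative families and countable probabilities *)

Lemma esumZl (R : realType) (T : choiceType) (r : R) (f : T -> R) :
  0 <= r -> (forall x, 0 <= f x) ->
  (\esum_(x in [set: T]) (r * f x)%:E = r%:E * \esum_(x in [set: T]) (f x)%:E)%E.
Proof.
move=> r0 f0; rewrite /esum -ereal_supZl //; last first.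
  by apply/set0P; exists 0%E; exists set0; [exact: fsets_set0|rewrite fsbig_set0].
congr ereal_sup; rewrite image_comp; apply: eq_imagel => A [finA _] /=.
by rewrite ge0_mule_fsumr // => x; rewrite lee_fin.
Qed.

Lemma esum_pair (R : realType) (A B : choiceType) (f : A * B -> \bar R) :
  (forall x, 0 <= f x)%E ->
  (\esum_(x in [set: (A * B)%type]) f x =
   \esum_(a in [set: A]) \esum_(b in [set: B]) f (a, b))%E.
Proof.
move=> f0; rewrite esum_esum //.
rewrite (_ : [set: _] `*`` (fun=> [set: _]) = [set: (A * B)%type]); last first.
  by apply/seteqP; split.
by apply: eq_esum => -[].
Qed.

Lemma esum_exchange (R : realType) (A B : choiceType) (f : A -> B -> \bar R) :
  (forall a b, 0 <= f a b)%E ->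
  (\esum_(a in [set: A]) \esum_(b in [set: B]) f a b =
   \esum_(b in [set: B]) \esum_(a in [set: A]) f a b)%E.
Proof.
move=> f0; rewrite -(@esum_pair _ _ _ (fun x => f x.1 x.2)) //.
rewrite -(@esum_pair _ _ _ (fun x => f x.2 x.1)) //.
rewrite (@reindex_esum _ _ _ [set: (B * A)%type] _ (fun x => (x.2, x.1))) //.
split => // [[x1 x2] [y1 y2] _ _ [-> ->] //|[a b] _].
by exists (b, a).
Qed.

Lemma esum_finite_support (R : realType) (T : choiceType) (A : finType)
    (h : A -> T) (f : T -> \bar R) :
  injective h -> (forall x, 0 <= f x)%E ->
  (forall x, (forall a, h a <> x) -> f x = 0)%E ->
  (\esum_(x in [set: T]) f x = \sum_(a : A) f (h a))%E.
Proof.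
move=> hI f0 fout.
rewrite (esumID [set h a | a in [set: A]]) // !setTI.
rewrite [X in (_ + X)%E]esum1 ?adde0; last first.
  by move=> x /= nx; apply: fout => a ha; apply: nx; exists a.
rewrite esum_image; last by move=> x y _ _; exact: hI.
rewrite esum_fset //; last exact: finite_finset.
rewrite (fsbigE (enum A)) ?enum_uniq //; last first.
  by move=> a; rewrite mem_enum.
rewrite big_enum_cond; apply: eq_bigl => a; rewrite inE; exact/asboolP.
Qed.

Lemma esum_fin (R : realType) (A : finType) (f : A -> R) :
  (forall a, 0 <= f a) ->
  (\esum_(a in [set: A]) (f a)%:E = (\sum_a f a)%:E)%E.
Proof.
move=> f0; rewrite (esum_finite_support (h := id)) ?sumEFin //.
by move=> a /(_ a).
Qed.

Lemma esum_ord (R : realType) (n : nat) (f : nat -> R) :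
  (forall c, 0 <= f c) -> (forall c, (n <= c)%N -> f c = 0) ->
  (\esum_(c in [set: nat]) (f c)%:E = (\sum_(c < n) f c)%:E)%E.
Proof.
move=> f0 fn; rewrite (esum_finite_support (h := @nat_of_ord n)) ?sumEFin //.
  exact: ord_inj.
move=> c nc; rewrite fn // leqNgt; apply/negP => cn.
exact: (nc (Ordinal cn)).
Qed.

Lemma esum_box (R : realType) (K : finType) (n : nat) (f : K * nat * nat -> R) :
  (forall x, 0 <= f x) ->
  (forall x, f x <> 0 -> (x.1.2 < n)%N /\ (x.2 < n)%N) ->
  (\esum_(x in [set: (K * nat * nat)%type]) (f x)%:E =
   (\sum_k \sum_(c < n) \sum_(d < n) f (k, nat_of_ord c, nat_of_ord d))%:E)%E.
Proof.
move=> f0 fn.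
rewrite (esum_finite_support
  (h := fun y : K * 'I_n * 'I_n => (y.1.1, nat_of_ord y.1.2, nat_of_ord y.2))).
- rewrite sumEFin; congr EFin; rewrite pair_bigA /= pair_bigA /=.
  by apply: eq_bigr => -[[]].
- by move=> [[k c] d] [[k' c'] d'] /= [-> /ord_inj -> /ord_inj ->].
- by move=> x; rewrite lee_fin.
- move=> [[k c] d] hx; have [->//|/fn[/= cn dn]] := pselect (f (k, c, d) = 0).
  by have := hx (k, Ordinal cn, Ordinal dn).
Qed.

Lemma esum_triple (R : realType) (K : choiceType)
    (f : K * nat * nat -> \bar R) :
  (forall x, 0 <= f x)%E ->
  (\esum_(x in [set: (K * nat * nat)%type]) f x =
   \esum_(k in [set: K]) \esum_(c in [set: nat]) \esum_(d in [set: nat])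
     f (k, c, d))%E.
Proof.
move=> f0; rewrite esum_pair // esum_pair // => x.
exact: esum_ge0.
Qed.

Lemma fineK_esum (R : realType) (T : choiceType) (f g : T -> R) :
  (forall x, 0 <= f x <= g x) ->
  (\esum_(x in [set: T]) (g x)%:E < +oo)%E ->
  ((fine (\esum_(x in [set: T]) (f x)%:E))%:E =
   \esum_(x in [set: T]) (f x)%:E)%E.
Proof.
move=> fg goo; apply: fineK; rewrite ge0_fin_numE.
  apply: le_lt_trans goo; apply: le_esum => x _.
  by rewrite lee_fin; case/andP: (fg x).
by apply: esum_ge0 => x _; rewrite lee_fin; case/andP: (fg x).
Qed.

Lemma fine_esum_ge0 (R : realType) (T : choiceType) (f : T -> R) :
  (forall x, 0 <= f x) -> 0 <= fine (\esum_(x in [set: T]) (f x)%:E).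
Proof.
by move=> f0; apply/fine_ge0/esum_ge0 => x _; rewrite lee_fin.
Qed.

Section Distributions.
Context (R : realType).

Lemma fineK_esum_le_mass (T : choiceType) (p : distr R T) (f : T -> R) :
  (forall x, 0 <= f x <= p x) ->
  ((fine (\esum_(x in [set: T]) (f x)%:E))%:E =
   \esum_(x in [set: T]) (f x)%:E)%E.
Proof. by move=> fp; apply: (fineK_esum fp); rewrite mass_sum1 ltry. Qed.

Lemma le_term_esum (T : choiceType) (A : set T) (f : T -> \bar R) x :
  (forall x, 0 <= f x)%E -> A x -> (f x <= \esum_(y in A) f y)%E.
Proof.
move=> f0 Ax; apply: esum_ge; exists [set x]; last by rewrite fsbig_set1.
by split => // y ->.
Qed.

Lemma mass_le1 (T : choiceType) (p : distr R T) x : p x <= 1.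
Proof.
rewrite -lee_fin -(mass_sum1 p).
apply: (@le_term_esum _ setT (fun x => (p x)%:E)) => // y.
by rewrite lee_fin mass_ge0.
Qed.

Lemma mass_out (T : choiceType) (p : distr R T) (A : set T) x :
  almost_surely_in p A -> ~ A x -> p x = 0.
Proof.
move=> pA nAx; have := mass_sum1 p.
have p0 y : (0 <= (p y)%:E)%E by rewrite lee_fin mass_ge0.
rewrite (esumID A) ?setTI // pA.
have := @le_term_esum _ (~` A) (fun x => (p x)%:E) x p0 nAx.
case: esum => [r| |] //= + [] /eqP; rewrite lee_fin.
rewrite -[X in _ == X]addr0 (inj_eq (addrI _)) => + /eqP r0; rewrite r0 => px.
by apply/eqP; rewrite eq_le px mass_ge0.
Qed.

Lemma almost_surely_inP (T : choiceType) (p : distr R T) (A : set T) :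
  (forall x, ~ A x -> p x = 0) -> almost_surely_in p A.
Proof.
move=> p0; rewrite /almost_surely_in -(mass_sum1 p) esum_mkcond.
apply: eq_esum => x _; case: ifPn => // /negP xA; rewrite p0 //.
by move=> Ax; apply: xA; rewrite inE.
Qed.

Lemma sum_mass (A : finType) (p : distr R A) : \sum_a p a = 1.
Proof.
have := mass_sum1 p; rewrite esum_fin => [[]//|a]; exact: mass_ge0.
Qed.

Lemma fin_distr_subproof (A : finType) (f : A -> R) :
  (forall a, 0 <= f a) -> \sum_a f a = 1 ->
  (\esum_(a in [set: A]) (f a)%:E = 1%:E)%E.
Proof. by move=> f0 f1; rewrite esum_fin // f1. Qed.

Definition fin_distr (A : finType) (f : A -> R) (f0 : forall a, 0 <= f a)
  (f1 : \sum_a f a = 1) : distr R A := Distr f0 (fin_distr_subproof f0 f1).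

Lemma dirac_subproof (T : choiceType) (a : T) :
  (\esum_(x in [set: T]) ((x == a)%:R : R)%:E = 1%:E)%E.
Proof.
rewrite (esum_finite_support (h := fun _ : unit => a)) //.
- by rewrite big_const card_unit /= eqxx addr0.
- by move=> [] [].
- by move=> x /(_ tt) /eqP; rewrite eq_sym => /negbTE ->.
Qed.

Definition dirac_distr (T : choiceType) (a : T) : distr R T :=
  Distr (fun x => ler0n R (x == a)) (dirac_subproof a).

Section Bind.
Context (A B : choiceType) (p : distr R A) (k : A -> distr R B).

Definition bind_mass (b : B) : R :=
  fine (\esum_(a in [set: A]) (p a * k a b)%:E).

Lemma bind_massE b : ((bind_mass b)%:E = \esum_(a in [set: A]) (p a * k a b)%:E)%E.
Proof.
apply: (fineK_esum_le_mass (p := p)) => a.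
by rewrite mulr_ge0 ?mass_ge0 //= ler_piMr ?mass_ge0 ?mass_le1.
Qed.

Lemma bind_mass_ge0 b : 0 <= bind_mass b.
Proof. by apply: fine_esum_ge0 => a; rewrite mulr_ge0 ?mass_ge0. Qed.

Lemma bind_mass_sum1 : (\esum_(b in [set: B]) (bind_mass b)%:E = 1%:E)%E.
Proof.
under eq_esum do rewrite bind_massE.
rewrite esum_exchange; last by move=> *; rewrite lee_fin mulr_ge0 ?mass_ge0.
under eq_esum => a _.
  rewrite esumZl ?mass_ge0 //; last exact: mass_ge0.
  rewrite mass_sum1 mule1; over.
exact: mass_sum1.
Qed.

Definition dbind : distr R B := Distr bind_mass_ge0 bind_mass_sum1.

End Bind.

Section Garbling.
Context (K : finType).
Implicit Types (u v w : info_structure R K) (q : garbling R).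

(** Garbling a signal moves mass within each slice of fixed state and fixed
    other signal, so it preserves total mass.  Used with w = u for the total mass of q.u,
    and with w = |u - v| for the contraction of the distance. *)
Lemma esum_garble1 (w : K * nat * nat -> R) q : (forall x, 0 <= w x) ->
  (\esum_(x in [set: (K * nat * nat)%type]) \esum_(c' in [set: nat])
     (w (x.1.1, c', x.2) * q c' x.1.2)%:E =
   \esum_(x in [set: (K * nat * nat)%type]) (w x)%:E)%E.
Proof.
move=> w0.
have wq0 (x : K * nat * nat) c c' : (0 <= (w x * q c c')%:E)%E.
  by rewrite lee_fin mulr_ge0 ?mass_ge0.
rewrite esum_triple; last by move=> x; exact: esum_ge0.
rewrite [RHS]esum_triple; last by move=> x; rewrite lee_fin.
apply: eq_esum => k _ /=.
rewrite esum_exchange; last by move=> *; exact: esum_ge0.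
rewrite [RHS]esum_exchange; last by move=> *; rewrite lee_fin.
apply: eq_esum => d _.
rewrite esum_exchange //; apply: eq_esum => c' _.
by rewrite esumZl ?mass_sum1 ?mule1 // => *; exact: mass_ge0.
Qed.

Lemma esum_garble2 (w : K * nat * nat -> R) q : (forall x, 0 <= w x) ->
  (\esum_(x in [set: (K * nat * nat)%type]) \esum_(d' in [set: nat])
     (w (x.1.1, x.1.2, d') * q d' x.2)%:E =
   \esum_(x in [set: (K * nat * nat)%type]) (w x)%:E)%E.
Proof.
move=> w0.
have wq0 (x : K * nat * nat) c c' : (0 <= (w x * q c c')%:E)%E.
  by rewrite lee_fin mulr_ge0 ?mass_ge0.
rewrite esum_triple; last by move=> x; exact: esum_ge0.
rewrite [RHS]esum_triple; last by move=> x; rewrite lee_fin.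
apply: eq_esum => k _ /=; apply: eq_esum => c _.
rewrite esum_exchange //; apply: eq_esum => d' _.
by rewrite esumZl ?mass_sum1 ?mule1 // => *; exact: mass_ge0.
Qed.

Lemma garble1E q u k c d :
  ((garble1 q u (k, c, d))%:E =
   \esum_(c' in [set: nat]) (u (k, c', d) * q c' c)%:E)%E.
Proof.
apply: (fineK_esum (g := fun c' => u (k, c', d))) => [c'|].
  by rewrite mulr_ge0 ?mass_ge0 //= ler_piMr ?mass_ge0 ?mass_le1.
apply: (@le_lt_trans _ _ 1%E); last exact: ltry.
have u0 x : (0 <= (u x)%:E)%E by rewrite lee_fin mass_ge0.
rewrite -(mass_sum1 u) esum_triple //.
under [leRHS]eq_esum do rewrite esum_exchange //.
apply: le_trans; last first.
  apply: (@le_term_esum _ _ _ k) => // x.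
  by apply: esum_ge0 => *; exact: esum_ge0.
apply: le_trans; last first.
  apply: (@le_term_esum _ _ _ d) => // x.
  exact: esum_ge0.
by [].
Qed.

Lemma garble2E q u k c d :
  ((garble2 u q (k, c, d))%:E =
   \esum_(d' in [set: nat]) (u (k, c, d') * q d' d)%:E)%E.
Proof.
apply: (fineK_esum (g := fun d' => u (k, c, d'))) => [d'|].
  by rewrite mulr_ge0 ?mass_ge0 //= ler_piMr ?mass_ge0 ?mass_le1.
apply: (@le_lt_trans _ _ 1%E); last exact: ltry.
have u0 x : (0 <= (u x)%:E)%E by rewrite lee_fin mass_ge0.
rewrite -(mass_sum1 u) esum_triple //.
apply: le_trans; last first.
  apply: (@le_term_esum _ _ _ k) => // x.
  by apply: esum_ge0 => *; exact: esum_ge0.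
apply: le_trans; last first.
  apply: (@le_term_esum _ _ _ c) => // x.
  exact: esum_ge0.
by [].
Qed.

Lemma garble1_ge0 q u x : 0 <= garble1 q u x.
Proof.
case: x => [[k c] d].
by apply: fine_esum_ge0 => c'; rewrite mulr_ge0 ?mass_ge0.
Qed.

Lemma garble2_ge0 q u x : 0 <= garble2 u q x.
Proof.
case: x => [[k c] d].
by apply: fine_esum_ge0 => d'; rewrite mulr_ge0 ?mass_ge0.
Qed.

Lemma garble1_sum1 q u :
  (\esum_(x in [set: (K * nat * nat)%type]) (garble1 q u x)%:E = 1%:E)%E.
Proof.
rewrite -(mass_sum1 u) -(esum_garble1 q (mass_ge0 u)).
by apply: eq_esum => -[[k c] d] _; rewrite garble1E.
Qed.

Lemma garble2_sum1 q u :
  (\esum_(x in [set: (K * nat * nat)%type]) (garble2 u q x)%:E = 1%:E)%E.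
Proof.
rewrite -(mass_sum1 u) -(esum_garble2 q (mass_ge0 u)).
by apply: eq_esum => -[[k c] d] _; rewrite garble2E.
Qed.

Definition garbled1 q u : info_structure R K :=
  Distr (garble1_ge0 q u) (garble1_sum1 q u).

Definition garbled2 u q : info_structure R K :=
  Distr (garble2_ge0 q u) (garble2_sum1 q u).

Lemma l1distE u v :
  ((l1dist u v)%:E =
   \esum_(x in [set: (K * nat * nat)%type]) `|u x - v x|%:E)%E.
Proof.
apply: (fineK_esum (g := fun x => u x + v x)) => [x|].
  rewrite normr_ge0 /= (le_trans (ler_normB _ _)) //.
  by rewrite !ger0_norm ?mass_ge0.
under eq_esum do rewrite EFinD.
by rewrite esumD ?mass_sum1 ?ltry // => *; rewrite lee_fin mass_ge0.
Qed.

Lemma l1dist_triangle v u w : l1dist u w <= l1dist u v + l1dist v w.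
Proof.
rewrite -lee_fin EFinD (l1distE u w) (l1distE u v) (l1distE v w).
rewrite -esumD; do ?by move=> *; rewrite lee_fin.
by apply: le_esum => x _; rewrite -EFinD lee_fin; exact: ler_distD.
Qed.

Lemma l1distC u v : l1dist u v = l1dist v u.
Proof. by congr fine; apply: eq_esum => x _; rewrite distrC. Qed.

(** |a - b| + 2 min(a, b) = a + b, summed over all triples.  This turns the
    distance into a function of the common mass only. *)
Lemma l1dist_overlap u v :
  ((l1dist u v)%:E + 2%:E *
   (\esum_(x in [set: (K * nat * nat)%type]) (Num.min (u x) (v x))%:E) = 2%:E)%E.
Proof.
rewrite (l1distE u v) -esumZl //; last by move=> x; rewrite le_min !mass_ge0.
rewrite -esumD; last 2 first.
- by move=> *; rewrite lee_fin.
- by move=> *; rewrite lee_fin mulr_ge0 // le_min !mass_ge0.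
transitivity (\esum_(x in [set: (K * nat * nat)%type]) ((u x)%:E + (v x)%:E))%E.
  apply: eq_esum => x _; rewrite -!EFinD; congr EFin.
  by case: (leP (u x) (v x)) => h; [rewrite ler0_norm|rewrite gtr0_norm]; lra.
by rewrite esumD ?mass_sum1 // => *; rewrite lee_fin mass_ge0.
Qed.

End Garbling.
End Distributions.

(** * Farkas lemma and saddle points of bilinear forms *)

(** Induction on the number m of rows (Bartl).  If the implication already
    holds without the last row, its multiplier is 0.  Otherwise some x0
    violates it, the last row is positive at x0, and projecting along x0 onto
    the kernel of the last row gives the induction hypothesis for the rows A'
    and the objective b', which vanish at x0. *)
Lemma farkas_nat (R : realFieldType) (T : finType) (m : nat) (A : nat -> T -> R)
    (b : T -> R) :
  (forall x : T -> R, (forall p, (p < m)%N -> \sum_t A p t * x t <= 0) ->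
     \sum_t b t * x t <= 0) ->
  exists lam : nat -> R, (forall p, 0 <= lam p) /\
    forall t, b t = \sum_(p < m) lam p * A p t.
Proof.
elim: m A b => [|m IH] A b Hb.
  exists (fun=> 0); split => // t; rewrite big_ord0.
  have := Hb b (fun p => fun F : (p < 0)%N => False_ind _ (notF F)).
  have sq s : 0 <= b s * b s by rewrite -expr2 sqr_ge0.
  move=> h; have /eqP : \sum_t b t * b t = 0.
    by apply/eqP; rewrite eq_le h sumr_ge0.
  rewrite psumr_eq0 // => /allP /(_ t (mem_index_enum _)) /=.
  by rewrite mulf_eq0 orbb => /eqP.
have [Hm|] := pselect (forall x : T -> R,
    (forall p, (p < m)%N -> \sum_t A p t * x t <= 0) -> \sum_t b t * x t <= 0).
  have [lam [lam0 lamE]] := IH _ _ Hm.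
  exists (fun p => if (p < m)%N then lam p else 0); split.
    by move=> p; case: ifP.
  move=> t; rewrite big_ord_recr /= ltnn mul0r addr0 lamE.
  by apply: eq_bigr => p _; rewrite ltn_ord.
move=> /existsNP[x0 /not_implyP[x0A /negP]]; rewrite -ltNge => bx0.
have Ax0 : 0 < \sum_t A m t * x0 t.
  rewrite ltNge; apply/negP => Amx; move: bx0; rewrite ltNge => /negP; apply.
  apply: Hb => p; rewrite ltnS leq_eqVlt => /orP[/eqP -> //|]; exact: x0A.
set al := \sum_t A m t * x0 t in Ax0.
(* normalized so that the last row takes the value 1 at x1 *)
pose x1 t := x0 t / al.
have x1E (f : T -> R) : \sum_t f t * x1 t = (\sum_t f t * x0 t) / al.
  by rewrite mulr_suml; apply: eq_bigr => t _; rewrite mulrA.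
pose ax p := \sum_t A p t * x1 t; pose bx := \sum_t b t * x1 t.
pose A' p t := A p t - ax p * A m t.
pose b' t := b t - bx * A m t.
have [x HA'|lam [lam0 lamE]] := IH A' b'.
  (* the projection of x along x1 onto the kernel of the last row *)
  pose z t := x t - (\sum_t A m t * x t) * x1 t.
  have zE (f : T -> R) : \sum_t f t * z t =
      \sum_t (f t - (\sum_t f t * x1 t) * A m t) * x t.
    under eq_bigr do rewrite mulrBr mulrCA.
    under [RHS]eq_bigr do rewrite mulrBl -mulrA.
    by rewrite !big_split /= !sumrN -!mulr_sumr mulrC.
  have -> : \sum_t b' t * x t = \sum_t b t * z t by rewrite zE.
  apply: Hb => p; rewrite ltnS leq_eqVlt => /orP[/eqP ->|pm].
    rewrite zE x1E divff ?gt_eqF // big1 // => t _.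
    by rewrite mul1r subrr mul0r.
  by rewrite zE; exact: HA'.
exists (fun p => if (p < m)%N then lam p else
   bx - \sum_(i < m) lam i * ax i); split.
  move=> p; case: ifP => // _; rewrite subr_ge0 (@le_trans _ _ 0) //.
    rewrite -oppr_ge0 -sumrN sumr_ge0 // => i _; rewrite -mulrN mulr_ge0 //.
    by rewrite oppr_ge0 /ax x1E pmulr_lle0 ?invr_gt0 // x0A.
  by rewrite /bx x1E divr_ge0 // ltW.
move=> t; rewrite big_ord_recr /= ltnn.
have -> : b t = b' t + bx * A m t by rewrite subrK.
have -> : \sum_(p < m) (if (p < m)%N then lam p else
    bx - \sum_(i < m) lam i * ax i) * A p t = \sum_(p < m) lam p * A p t.
  by apply: eq_bigr => p _; rewrite ltn_ord.
have -> : b' t = \sum_(p < m) lam p * A p t -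
    (\sum_(p < m) lam p * ax p) * A m t.
  by rewrite lamE mulr_suml -sumrB; apply: eq_bigr => p _; rewrite mulrBr mulrA.
by rewrite mulrBl; ring.
Qed.

Lemma farkas (R : realFieldType) (P T : finType) (A : P -> T -> R) (b : T -> R) :
  (forall x : T -> R, (forall p, \sum_t A p t * x t <= 0) ->
     \sum_t b t * x t <= 0) ->
  exists lam : P -> R, (forall p, 0 <= lam p) /\
    forall t, b t = \sum_p lam p * A p t.
Proof.
move=> Hb; pose f (i : nat) : option P := onth (enum P) i.
pose A' i t := if f i is Some p then A p t else 0.
have fE p : f (enum_rank p) = Some p.
  rewrite /f onthE (nth_map p) ?nth_enum_rank //.
  by rewrite -cardE ltn_ord.
have [x HA|lam [lam0 lamE]] := @farkas_nat R T #|P| A' b.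
  apply: Hb => p; have := HA (enum_rank p) (ltn_ord _).
  by under eq_bigr do rewrite /A' fE.
exists (fun p => lam (enum_rank p)); split => // t.
rewrite lamE (reindex (@enum_rank P)) /=; last first.
  by exists enum_val => ? _; rewrite (enum_rankK, enum_valK).
by apply: eq_bigr => p _; rewrite /A' fE.
Qed.

Section Saddle.
Context (R : realType).

(** A point of the product over X of the simplices on I: a behavioural
    strategy with information sets X and actions I. *)
Definition stochastic (X I : finType) (s : X -> I -> R) : Prop :=
  (forall x i, 0 <= s x i) /\ (forall x, \sum_i s x i = 1).

Definition bilin (X I Y J : finType) (M : X -> I -> Y -> J -> R)
    (s : X -> I -> R) (t : Y -> J -> R) : R :=
  \sum_x \sum_i \sum_y \sum_j s x i * t y j * M x i y j.

Lemma bilinE1 (X I Y J : finType) (M : X -> I -> Y -> J -> R) s t :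
  bilin M s t = \sum_y \sum_j t y j * (\sum_x \sum_i s x i * M x i y j).
Proof.
rewrite /bilin pair_bigA exchange_big /=; apply: eq_bigr => y _.
rewrite exchange_big /=; apply: eq_bigr => j _.
rewrite pair_bigA mulr_sumr /=; apply: eq_bigr => -[x i] _ /=.
by ring.
Qed.

Lemma bilinE2 (X I Y J : finType) (M : X -> I -> Y -> J -> R) s t :
  bilin M s t = \sum_x \sum_i s x i * (\sum_y \sum_j t y j * M x i y j).
Proof.
apply: eq_bigr => x _; apply: eq_bigr => i _.
rewrite !pair_bigA mulr_sumr /=; apply: eq_bigr => -[y j] _ /=; ring.
Qed.

(** The minimum over t of bilin M s t is reached separately at each y; alpha y
    is a lower bound for the contribution of y. *)
Definition guarantees (X I Y J : finType) (M : X -> I -> Y -> J -> R)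
    (s : X -> I -> R) (alpha : Y -> R) : Prop :=
  stochastic s /\ forall y j, alpha y <= \sum_x \sum_i s x i * M x i y j.

Definition maxmin (X I Y J : finType) (M : X -> I -> Y -> J -> R) : R :=
  sup [set a | exists s alpha, guarantees M s alpha /\ a = \sum_y alpha y].

Lemma guaranteesP (X I Y J : finType) (M : X -> I -> Y -> J -> R) s alpha t :
  guarantees M s alpha -> stochastic t -> \sum_y alpha y <= bilin M s t.
Proof.
move=> [_ ga] [t0 t1]; rewrite bilinE1; apply: ler_sum => y _.
rewrite -[leLHS]mul1r -(t1 y) mulr_suml; apply: ler_sum => j _.
exact: ler_wpM2l.
Qed.

Definition pure (X I : finType) (i0 : I) : X -> I -> R :=
  fun _ i => (i == i0)%:R.

Lemma sum_pure (I : finType) (i0 : I) (f : I -> R) :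
  \sum_i (i == i0)%:R * f i = f i0.
Proof.
by rewrite (bigD1 i0) //= eqxx mul1r big1 ?addr0 // => i /negbTE ->; rewrite mul0r.
Qed.

Lemma stochastic_pure (X I : finType) (i0 : I) : stochastic (@pure X I i0).
Proof.
split=> [x i|x]; first exact: ler0n.
by rewrite -(sum_pure i0 (fun=> 1)); apply: eq_bigr => i _; rewrite mulr1.
Qed.

(** A pure strategy provides a feasible point; any guaranteed amount is bounded
    by what s gets against the constant choice j0. *)
Lemma maxmin_has_sup (X I Y J : finType) (M : X -> I -> Y -> J -> R)
    (i0 : I) (j0 : J) :
  has_sup [set a | exists s alpha, guarantees M s alpha /\ a = \sum_y alpha y].
Proof.
split.
  pose s := @pure X I i0.
  pose al y := - \sum_j `|\sum_x \sum_i s x i * M x i y j|.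
  exists (\sum_y al y); exists s, al; split => //; split; first exact: stochastic_pure.
  move=> y j; rewrite /al (bigD1 j) //= opprD.
  rewrite (@le_trans _ _ (- `|\sum_x \sum_i s x i * M x i y j|)) //; last first.
    by rewrite lerNl -normrN ler_norm.
  by rewrite gerDl oppr_le0 sumr_ge0.
exists (\sum_y \sum_x \sum_i `|M x i y j0|) => _ [s [al [[[s0 s1] ga] ->]]].
apply: ler_sum => y _; apply: le_trans (ga y j0) _.
apply: ler_sum => x _; apply: ler_sum => i _.
apply: le_trans (ler_norm _) _; rewrite normrM ler_piMl //.
rewrite ger0_norm // -(s1 x) (bigD1 i) //= lerDl.
by rewrite sumr_ge0.
Qed.

Section Half.
Context (X I Y J : finType) (M : X -> I -> Y -> J -> R)
  (x0 : X) (i0 : I) (j0 : J).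

Let V := maxmin M.

(* The variables are a homogenized strategy (s, alpha, tau), of total mass tau
   at each x.  The constraints say that s >= 0, that alpha y is at most what s
   gets at (y, j), and that s x has mass exactly tau (two inequalities for each
   x, indexed by a boolean).  The objective is \sum_y alpha y - V tau. *)
Let T := (X * I + (Y + unit))%type.
Let P := ((X * I + Y * J) + X * bool)%type.

Let obj (t : T) : R :=
  match t with inl _ => 0 | inr (inl _) => 1 | inr (inr _) => - V end.

Let con (p : P) (t : T) : R :=
  match p, t with
  | inl (inl xi), inl xi' => - (xi' == xi)%:R
  | inl (inl _), _ => 0
  | inl (inr (y, j)), inl (x, i) => - M x i y j
  | inl (inr (y, j)), inr (inl y') => (y' == y)%:R
  | inl (inr (y, j)), inr (inr _) => 0
  | inr (x, e), inl (x', i) => (-1) ^+ e * (x' == x)%:R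
  | inr (x, e), inr (inl _) => 0
  | inr (x, e), inr (inr _) => (-1) ^+ e * - 1
  end.

Let sumT (f : T -> R) : \sum_t f t =
  \sum_x \sum_i f (inl (x, i)) + (\sum_y f (inr (inl y)) + f (inr (inr tt))).
Proof.
rewrite big_sumType /= big_sumType /= pair_bigA /=; congr (_ + (_ + _)).
  by apply: eq_bigr => -[].
by rewrite (big_pred1 tt) // => -[].
Qed.

Let sumP (f : P -> R) : \sum_p f p =
  \sum_x \sum_i f (inl (inl (x, i))) + \sum_y \sum_j f (inl (inr (y, j))) +
  \sum_x (f (inr (x, true)) + f (inr (x, false))).
Proof.
rewrite big_sumType /= big_sumType /= !pair_bigA /=; congr (_ + _ + _).
- by apply: eq_bigr => -[].
- by apply: eq_bigr => -[].
- transitivity (\sum_x \sum_e f (inr (x, e))).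
    by rewrite pair_bigA; apply: eq_bigr => -[].
  by apply: eq_bigr => x _; rewrite big_bool.
Qed.

(* By definition of V when tau > 0, by scaling.  When tau = 0 the strategy
   vanishes, hence alpha <= 0. *)
Let feasible_obj (z : T -> R) :
  (forall p, \sum_t con p t * z t <= 0) -> \sum_t obj t * z t <= 0.
Proof.
move=> zA; pose tau := z (inr (inr tt)).
pose s x i := z (inl (x, i)); pose al y := z (inr (inl y)).
have s0 x i : 0 <= s x i.
  have := zA (inl (inl (x, i))); rewrite sumT /= pair_bigA /=.
  rewrite mul0r [X in _ + (X + _)]big1 ?addr0; last by move=> *; rewrite mul0r.
  under eq_bigr => q _ do rewrite -surjective_pairing mulNr.
  by rewrite sumrN sum_pure oppr_le0.
have s1 x : \sum_i s x i = tau.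
  have h (e : bool) : (-1) ^+ e * (\sum_i s x i - tau) <= 0.
    have := zA (inr (x, e)); rewrite sumT /=.
    rewrite [X in _ + (X + _)]big1 ?add0r; last by move=> *; rewrite mul0r.
    rewrite (bigD1 x) //= [X in _ + X + _]big1; last first.
      by move=> x' /negbTE ->; rewrite big1 // => *; rewrite mulr0 mul0r.
    under eq_bigr do rewrite eqxx mulr1.
    by rewrite -mulr_sumr addr0 mulrBr mulrN1 mulNr.
  have := h true; have := h false.
  by rewrite expr0 expr1 mul1r mulN1r => ? ?; lra.
have ga y j : al y <= \sum_x \sum_i s x i * M x i y j.
  have := zA (inl (inr (y, j))); rewrite sumT /= mul0r addr0 sum_pure.
  rewrite -/(al y) => h; rewrite -subr_le0 (le_trans _ h) // addrC lerD2r.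
  rewrite -sumrN; apply: ler_sum => x _; rewrite -sumrN; apply: ler_sum => i _.
  by rewrite mulNr mulrC.
have tau0 : 0 <= tau by rewrite -(s1 x0) sumr_ge0.
rewrite sumT /= [X in X + _]big1 ?add0r; last first.
  by move=> *; rewrite big1 // => *; rewrite mul0r.
under eq_bigr do rewrite mul1r.
rewrite mulNr subr_le0 -/tau.
have [tauE|tauN] := eqVneq tau 0.
  rewrite tauE mulr0; apply: sumr_le0 => y _.
  apply: le_trans (ga y j0) _; rewrite big1 // => x _; rewrite big1 // => i _.
  have /eqP := s1 x; rewrite tauE psumr_eq0 // => /allP /(_ i (mem_index_enum _)).
  by move=> /eqP ->; rewrite mul0r.
have taup : 0 < tau by rewrite lt_neqAle eq_sym tauN.
rewrite -ler_pdivrMr //; apply: (sup_upper_bound (maxmin_has_sup M i0 j0)).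
exists (fun x i => s x i / tau), (fun y => al y / tau).
split; last by rewrite mulr_suml.
split; first split.
- by move=> x i; rewrite divr_ge0.
- by move=> x; rewrite -mulr_suml s1 divff.
- move=> y j; rewrite ler_pdivrMr //; apply: le_trans (ga y j) _.
  rewrite mulr_suml; apply: ler_sum => x _; rewrite mulr_suml.
  by apply: ler_sum => i _; rewrite mulrAC divfK.
Qed.

(** The Farkas multipliers of the constraints on alpha form an optimal strategy
    of the other player: be x, the multiplier of the mass constraint at x,
    bounds what each i gets at x against t, and these bounds sum to V. *)
Lemma dual_optimum : exists t, stochastic t /\
  forall s, stochastic s -> bilin M s t <= maxmin M.
Proof.
have [lam [lam0 lamE]] := farkas feasible_obj.
pose t y j := lam (inl (inr (y, j))).
pose be x := lam (inr (x, false)) - lam (inr (x, true)).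
have beV : \sum_x be x = V.
  have := lamE (inr (inr tt)); rewrite sumP /=.
  rewrite big1 ?add0r; last by move=> *; rewrite big1 // => *; rewrite mulr0.
  rewrite big1 ?add0r; last by move=> *; rewrite big1 // => *; rewrite mulr0.
  move=> /eqP; rewrite -eqr_opp opprK => /eqP ->; rewrite -sumrN.
  by apply: eq_bigr => x _; rewrite expr0 expr1 /be; lra.
have t1 y : \sum_j t y j = 1.
  have := lamE (inr (inl y)); rewrite sumP /=.
  rewrite big1 ?add0r; last by move=> *; rewrite big1 // => *; rewrite mulr0.
  rewrite [X in _ + X]big1 ?addr0; last by move=> *; rewrite !mulr0 addr0.
  move=> ->; rewrite (bigD1 y) //= [X in _ + X]big1 ?addr0.
    by apply: eq_bigr => j _; rewrite eqxx mulr1.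
  move=> y' /negbTE yy; rewrite big1 // => j _.
  by rewrite eq_sym yy mulr0.
have tM x i : \sum_y \sum_j t y j * M x i y j <= be x.
  have := lamE (inl (x, i)); rewrite sumP /=.
  rewrite [X in _ + X](bigD1 x) //= [X in _ + (_ + X)]big1 ?addr0; last first.
    by move=> x' /negbTE xx; rewrite eq_sym xx !mulr0 addr0.
  rewrite eqxx.
  have : 0 <= \sum_x' \sum_i' lam (inl (inl (x', i'))) * ((x, i) == (x', i'))%:R.
    apply: sumr_ge0 => x' _; apply: sumr_ge0 => i' _; rewrite mulr_ge0 ?ler0n //.
  under [X in _ -> 0 = X + _ + _ -> _]eq_bigr do
    under eq_bigr do rewrite mulrN.
  under [X in _ -> 0 = X + _ + _ -> _]eq_bigr do rewrite sumrN.
  under [X in _ -> 0 = _ + X + _ -> _]eq_bigr do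
    under eq_bigr do rewrite mulrN.
  under [X in _ -> 0 = _ + X + _ -> _]eq_bigr do rewrite sumrN.
  rewrite !sumrN expr0 expr1 /be /t.
  set S1 := \sum_x' _; set S2 := \sum_y _.
  by have -> : true%:R = 1 :> R by []; move=> ? ?; lra.
exists t; split; first by split => // y j; exact: lam0.
move=> s [s0 s1]; rewrite bilinE2 -/V -beV; apply: ler_sum => x _.
rewrite -[leRHS]mul1r -(s1 x) mulr_suml; apply: ler_sum => i _.
exact: ler_wpM2l.
Qed.

End Half.

Definition transpose_form (X I Y J : finType) (M : X -> I -> Y -> J -> R) :
  Y -> J -> X -> I -> R := fun y j x i => - M x i y j.

Lemma bilin_transpose (X I Y J : finType) (M : X -> I -> Y -> J -> R) s t :
  bilin (transpose_form M) t s = - bilin M s t.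
Proof.
rewrite bilinE1 bilinE2 -sumrN; apply: eq_bigr => x _.
rewrite -sumrN; apply: eq_bigr => i _; rewrite -mulrN -sumrN; congr (_ * _).
by apply: eq_bigr => y _; rewrite -sumrN; apply: eq_bigr => j _; rewrite mulrN.
Qed.

(** The minimax theorem.  The strategy s is the dual optimum of the transposed
    form; weak duality ([guaranteesP]) compares the two optimal values. *)
Lemma saddle_point (X I Y J : finType) (M : X -> I -> Y -> J -> R)
    (x0 : X) (i0 : I) (y0 : Y) (j0 : J) :
  exists s t (V : R), [/\ stochastic s, stochastic t,
    forall s', stochastic s' -> bilin M s' t <= V &
    forall t', stochastic t' -> V <= bilin M s t'].
Proof.
have [t [tk tV]] := dual_optimum M x0 i0 j0.
have [s [sk sV]] := dual_optimum (transpose_form M) y0 j0 i0.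
exists s, t, (maxmin M); split => // t' tk'.
have := sV _ tk'; rewrite bilin_transpose lerNl; apply: le_trans.
rewrite lerNr; apply: ge_sup.
  by case: (maxmin_has_sup (transpose_form M) j0 i0).
move=> _ [t1 [be [[t1k ga] ->]]]; rewrite lerNr.
apply: ge_sup; first by case: (maxmin_has_sup M i0 j0).
move=> _ [s1 [al [[s1k ga'] ->]]].
have := guaranteesP (conj s1k ga') t1k.
have := guaranteesP (conj t1k ga) s1k; rewrite bilin_transpose => h1 h2.
by lra.
Qed.

End Saddle.

(** * Truncation of information structures *)

Section Truncation.
Context (R : realType) (K : finType).
Implicit Types (u v : info_structure R K).

Lemma info_bounded_out n u k c d : info_bounded (Some n) u ->
  (n <= c)%N || (n <= d)%N -> u (k, c, d) = 0.
Proof.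
move=> un h; apply: (mass_out un) => -[] /=.
by move: h; rewrite (leqNgt n c) (leqNgt n d) => /orP[] /negP.
Qed.

Lemma info_boundedP n u :
  (forall k c d, (n <= c)%N || (n <= d)%N -> u (k, c, d) = 0) ->
  info_bounded (Some n) u.
Proof.
move=> un; apply: almost_surely_inP => -[[k c] d] /= h; apply: un.
by rewrite (leqNgt n c) (leqNgt n d) -negb_and; apply/negP => /andP.
Qed.

Lemma info_boundedW n m u : (n <= m)%N -> info_bounded (Some n) u ->
  info_bounded (Some m) u.
Proof.
move=> nm un; apply: info_boundedP => k c d h; apply: (info_bounded_out _ un).
by case/orP: h => h; rewrite (leq_trans nm h) ?orbT.
Qed.

Section Truncate.
Context (u : info_structure R K) (k0 : K) (n : nat).

Let box : set (K * nat * nat) := [set x | (x.1.2 <= n)%N /\ (x.2 <= n)%N].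
Let m := fine (\esum_(x in box) (u x)%:E).
Let u0 x : (0 <= (u x)%:E)%E.
Proof. by rewrite lee_fin mass_ge0. Qed.

Let mE : (m%:E = \esum_(x in box) (u x)%:E)%E.
Proof.
apply: fineK; rewrite ge0_fin_numE ?esum_ge0 //.
apply: (@le_lt_trans _ _ 1%E); last exact: ltry.
rewrite -(mass_sum1 u) [leRHS](@esumID _ _ box [set: _]) ?setTI // leeDl //.
exact: esum_ge0.
Qed.

Let outE : (\esum_(x in ~` box) (u x)%:E = (1 - m)%:E)%E.
Proof.
have := mass_sum1 u; rewrite (@esumID _ _ box [set: _]) ?setTI // -mE.
case: esum => [r| |] //= [] e; congr EFin; lra.
Qed.

Let m_le1 : 0 <= 1 - m.
Proof. by rewrite -lee_fin -outE; exact: esum_ge0. Qed.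

(** The mass outside the box is moved to the triple (k0, 0, 0). *)
Definition truncate_mass (x : K * nat * nat) : R :=
  (if x \in box then u x else 0) + (1 - m) * dirac_distr R (k0, 0%N, 0%N) x.

Lemma truncate_ge0 x : 0 <= truncate_mass x.
Proof.
rewrite addr_ge0 ?mulr_ge0 ?mass_ge0 //.
by case: ifP => // _; exact: mass_ge0.
Qed.

Let if_ge0 (A : set (K * nat * nat)) x : 0 <= if x \in A then u x else 0.
Proof. by case: ifP => // _; exact: mass_ge0. Qed.

Let esum_if (A : set (K * nat * nat)) :
  (\esum_(x in [set: (K * nat * nat)%type]) (if x \in A then u x else 0)%:E =
   \esum_(x in A) (u x)%:E)%E.
Proof. by rewrite [RHS]esum_mkcond; apply: eq_esum => x _; case: ifP. Qed.

Lemma truncate_sum1 :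
  (\esum_(x in [set: (K * nat * nat)%type]) (truncate_mass x)%:E = 1%:E)%E.
Proof.
under eq_esum do rewrite EFinD.
rewrite esumD; last 2 first.
- by move=> x _; rewrite lee_fin.
- by move=> x _; rewrite lee_fin mulr_ge0 ?mass_ge0.
rewrite esum_if -mE esumZl //.
by rewrite mass_sum1 mule1 -EFinD addrC subrK.
Qed.

Definition truncate : info_structure R K := Distr truncate_ge0 truncate_sum1.

Lemma truncate_bounded : info_bounded (Some n.+1) truncate.
Proof.
apply: info_boundedP => k c d h; rewrite /= /truncate_mass /=.
rewrite memNset /box /=; last first.
  by move=> [cn dn]; move: h; rewrite !ltnNge cn dn.
rewrite add0r; case: eqP => [[_ c0 d0]|]; last by rewrite mulr0.
by rewrite c0 d0 in h.
Qed.

Lemma truncate_dist :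
  ((l1dist u truncate)%:E <= 2%:E * (\esum_(x in ~` box) (u x)%:E))%E.
Proof.
rewrite (l1distE u truncate) outE -EFinM.
apply: (@le_trans _ _ (\esum_(x in [set: (K * nat * nat)%type])
   ((if x \in ~` box then u x else 0)%:E +
   ((1 - m) * dirac_distr R (k0, 0%N, 0%N) x)%:E))%E).
  apply: le_esum => x _; rewrite -EFinD lee_fin /= /truncate_mass in_setC.
  have d0 : 0 <= (1 - m) * (x == (k0, 0%N, 0%N))%:R by rewrite mulr_ge0.
  rewrite opprD addrA (le_trans (ler_normB _ _)) //= (ger0_norm d0) lerD2r.
  by case: ifP => _ /=; rewrite ?subrr ?normr0 // subr0 ger0_norm ?mass_ge0.
rewrite esumD; last 2 first.
- by move=> x _; rewrite lee_fin.
- by move=> x _; rewrite lee_fin mulr_ge0 ?mass_ge0.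
rewrite esum_if outE esumZl //.
by rewrite mass_sum1 mule1 -EFinD lee_fin; lra.
Qed.

End Truncate.

(** A finite set of triples carries mass at least 1 - e / 2, and it is contained
    in a box. *)
Lemma truncate_close u (k0 : K) (e : R) : 0 < e ->
  exists n u', info_bounded (Some n.+1) u' /\ l1dist u u' <= e.
Proof.
move=> e0.
have : ((1 - e / 2)%:E < \esum_(x in [set: (K * nat * nat)%type]) (u x)%:E)%E.
  by rewrite mass_sum1 lte_fin; lra.
move=> /ereal_sup_gt[_ [F [finF _] <-]] uF.
have [G FG] := (finite_seqP F).1 finF.
pose n := (\max_(x <- G) maxn x.1.2 x.2)%N.
exists n, (truncate u k0 n); split; first exact: truncate_bounded.
rewrite -lee_fin; apply: le_trans (truncate_dist _ _ _) _.
set box := [set x | _].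
have u0 x : (0 <= (u x)%:E)%E by rewrite lee_fin mass_ge0.
have : (\sum_(x \in F) (u x)%:E <= \esum_(x in box) (u x)%:E)%E.
  apply: esum_ge; exists F => //; split => // x; rewrite FG => /= xG.
  by apply/andP; rewrite -geq_max; exact: (@leq_bigmax_seq _ _ xpredT (fun x => maxn x.1.2 x.2)).
move=> /(lt_le_trans uF).
have := mass_sum1 u; rewrite (@esumID _ _ box [set: _]) ?setTI //.
have := @esum_ge0 R _ (~` box) (fun x => (u x)%:E) (fun x _ => u0 x).
case: (esum (~` box)) => [r| |] //=; case: (esum box) => [r'| |] //=.
rewrite -EFinM => _ [] rr; rewrite !lte_fin !lee_fin; lra.
Qed.

End Truncation.

(** * Payoffs of strategies, garblings as changes of strategy *)

Section Payoffs.
Context (R : realType) (K : finType).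
Implicit Types (u v : info_structure R K) (q : garbling R).

Section FixedGame.
Context (g : payoff R K).
Implicit Types (s : strategy1 g) (t : strategy2 g).

(** Summing over actions integrates out the strategies.  Used with w = u for the
    total probability, and with w = |u - v| for the comparison of payoffs. *)
Lemma esum_play (w : K * nat * nat -> R) s t : (forall x, 0 <= w x) ->
  (\sum_k \sum_i \sum_j \esum_(y in [set: (nat * nat)%type])
     (w (k, y.1, y.2) * s y.1 i * t y.2 j)%:E =
   \esum_(x in [set: (K * nat * nat)%type]) (w x)%:E)%E.
Proof.
move=> w0.
have wst0 k i j (y : nat * nat) :
    (0 <= (w (k, y.1, y.2) * s y.1 i * t y.2 j)%:E)%E.
  by rewrite lee_fin !mulr_ge0 ?mass_ge0.
have w0E x : (0 <= (w x)%:E)%E by rewrite lee_fin.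
rewrite esum_triple // (@esum_finite_support _ _ _ id) //; last 2 first.
- by move=> k; apply: esum_ge0 => *; exact: esum_ge0.
- by move=> k /(_ k).
apply: eq_bigr => k _.
under eq_bigr do rewrite -esum_sum //.
rewrite -esum_sum; last by move=> *; exact: sume_ge0.
rewrite -(@esum_pair _ _ _ (fun y => (w (k, y.1, y.2))%:E)) //.
apply: eq_esum => y _.
under eq_bigr => i _ do rewrite sumEFin -mulr_sumr sum_mass mulr1.
by rewrite sumEFin -mulr_sumr sum_mass mulr1.
Qed.

Lemma play_fin (w : K * nat * nat -> R) s t k i j : (forall x, 0 <= w x) ->
  (\esum_(x in [set: (K * nat * nat)%type]) (w x)%:E < +oo)%E ->
  ((fine (\esum_(y in [set: (nat * nat)%type])
     (w (k, y.1, y.2) * s y.1 i * t y.2 j)%:E))%:E =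
   \esum_(y in [set: (nat * nat)%type])
     (w (k, y.1, y.2) * s y.1 i * t y.2 j)%:E)%E.
Proof.
move=> w0 woo.
have wst0 k' i' j' (y : nat * nat) :
    (0 <= (w (k', y.1, y.2) * s y.1 i' * t y.2 j')%:E)%E.
  by rewrite lee_fin !mulr_ge0 ?mass_ge0.
have e0 k' i' j' : (0 <= \esum_(y in [set: (nat * nat)%type])
     (w (k', y.1, y.2) * s y.1 i' * t y.2 j')%:E)%E by exact: esum_ge0.
apply: fineK; rewrite ge0_fin_numE //; apply: le_lt_trans woo.
rewrite -(esum_play s t w0) (bigD1 k) //= (bigD1 i) //= (bigD1 j) //= -!addeA.
rewrite leeDl //; do 2? apply: adde_ge0.
all: by do 3? [apply: sume_ge0 => ? _].
Qed.

Lemma play_probE u s t k i j :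
  ((play_prob u s t k i j)%:E =
   \esum_(y in [set: (nat * nat)%type]) (u (k, y.1, y.2) * s y.1 i * t y.2 j)%:E)%E.
Proof.
by apply: play_fin; [exact: mass_ge0 | rewrite mass_sum1 ltry].
Qed.

Lemma play_prob_ge0 u s t k i j : 0 <= play_prob u s t k i j.
Proof. by apply: fine_esum_ge0 => y; rewrite !mulr_ge0 ?mass_ge0. Qed.

Lemma play_prob_sum1 u s t : \sum_k \sum_i \sum_j play_prob u s t k i j = 1.
Proof.
apply/EFin_inj; rewrite -(mass_sum1 u) -(esum_play s t (mass_ge0 u)).
rewrite -sumEFin; apply: eq_bigr => k _; rewrite -sumEFin.
apply: eq_bigr => i _; rewrite -sumEFin; apply: eq_bigr => j _.
exact: play_probE.
Qed.

Lemma play_prob_dist u v s t :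
  \sum_k \sum_i \sum_j `|play_prob u s t k i j - play_prob v s t k i j| <=
  l1dist u v.
Proof.
pose w (x : K * nat * nat) : R := `|u x - v x|.
have w0 x : 0 <= w x by exact: normr_ge0.
have woo : (\esum_(x in [set: (K * nat * nat)%type]) (w x)%:E < +oo)%E.
  by rewrite -(l1distE u v) ltry.
rewrite -lee_fin (l1distE u v) -(esum_play s t w0).
rewrite -sumEFin; apply: lee_sum => k _; rewrite -sumEFin.
apply: lee_sum => i _; rewrite -sumEFin; apply: lee_sum => j _.
rewrite -play_fin // lee_fin ler_norml.
have wst0 (f : K * nat * nat -> R) (y : nat * nat) : (forall x, 0 <= f x) ->
    (0 <= (f (k, y.1, y.2) * s y.1 i * t y.2 j)%:E)%E.
  by move=> f0; rewrite lee_fin !mulr_ge0 ?mass_ge0.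
have h (u1 u2 : info_structure R K) : (forall x, u1 x <= u2 x + w x) ->
    play_prob u1 s t k i j <= play_prob u2 s t k i j +
    fine (\esum_(y in [set: (nat * nat)%type])
     (w (k, y.1, y.2) * s y.1 i * t y.2 j)%:E).
  move=> u12; rewrite -lee_fin EFinD (play_probE u1 s t k i j) (play_probE u2 s t k i j).
  rewrite (play_fin s t k i j w0 woo) -esumD; last 2 first.
  - by move=> y _; apply: wst0 => x; exact: mass_ge0.
  - by move=> y _; apply: wst0 => x.
  apply: le_esum => y _; rewrite -EFinD lee_fin -!mulrDl.
  by rewrite !ler_wpM2r ?mass_ge0.
have /h uv x : u x <= v x + w x by rewrite /w -lerBlDl ler_norm.
have /h vu x : v x <= u x + w x by rewrite /w distrC -lerBlDl ler_norm.
by rewrite lerBlDl uv andbT lerNl opprB lerBlDl.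
Qed.

Lemma expected_payoff_bound u s t : -1 <= expected_payoff u s t <= 1.
Proof.
rewrite -ler_norml -(play_prob_sum1 u s t).
do 3 (apply: le_trans (ler_norm_sum _ _ _) _; apply: ler_sum => ? _).
rewrite normrM ger0_norm ?play_prob_ge0 // ler_piMr ?play_prob_ge0 //.
by rewrite ler_norml pay_bounded.
Qed.

Lemma expected_payoff_dist u v s t :
  expected_payoff u s t <= expected_payoff v s t + l1dist u v.
Proof.
rewrite -lerBlDl; apply: le_trans (play_prob_dist u v s t).
do 3 (rewrite -sumrB; apply: ler_sum => ? _).
rewrite -mulrBl; apply: le_trans (ler_norm _) _.
by rewrite normrM ler_piMr // ler_norml pay_bounded.
Qed.

Lemma play_prob_garble1 q u s t k i j :
  play_prob (garbled1 q u) s t k i j =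
  play_prob u ((fun c => dbind (q c) s) : strategy1 g) t k i j.
Proof.
apply/EFin_inj; rewrite !play_probE.
rewrite esum_pair; last by move=> *; rewrite lee_fin !mulr_ge0 ?mass_ge0.
rewrite [RHS]esum_pair; last by move=> *; rewrite lee_fin !mulr_ge0 ?mass_ge0.
rewrite [LHS]esum_exchange; last by move=> *; rewrite lee_fin !mulr_ge0 ?mass_ge0.
rewrite [RHS]esum_exchange; last by move=> *; rewrite lee_fin !mulr_ge0 ?mass_ge0.
apply: eq_esum => d _.
transitivity (\esum_(c in [set: nat]) \esum_(c' in [set: nat])
  (t d j * s c i * (u (k, c', d) * q c' c))%:E)%E.
  apply: eq_esum => c _; rewrite esumZl ?mulr_ge0 ?mass_ge0 //; last first.
    by move=> c'; rewrite mulr_ge0 ?mass_ge0.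
  by rewrite -garble1E -EFinM; congr EFin; rewrite [RHS]mulrC [X in _ = _ * X]mulrC mulrA.
rewrite esum_exchange; last by move=> *; rewrite lee_fin !mulr_ge0 ?mass_ge0.
apply: eq_esum => c' _.
transitivity (\esum_(c in [set: nat])
  (t d j * u (k, c', d) * (q c' c * s c i))%:E)%E.
  by apply: eq_esum => c _; congr EFin; ring.
rewrite esumZl ?mulr_ge0 ?mass_ge0 //; last first.
  by move=> c; rewrite mulr_ge0 ?mass_ge0.
by rewrite -bind_massE -EFinM; congr EFin; rewrite -[LHS]mulrA [LHS]mulrC.
Qed.

Lemma play_prob_garble2 q u s t k i j :
  play_prob (garbled2 u q) s t k i j =
  play_prob u s ((fun d => dbind (q d) t) : strategy2 g) k i j.
Proof.
apply/EFin_inj; rewrite !play_probE.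
rewrite esum_pair; last by move=> *; rewrite lee_fin !mulr_ge0 ?mass_ge0.
rewrite [RHS]esum_pair; last by move=> *; rewrite lee_fin !mulr_ge0 ?mass_ge0.
apply: eq_esum => c _ /=.
transitivity (\esum_(d in [set: nat]) \esum_(d' in [set: nat])
  (t d j * s c i * (u (k, c, d') * q d' d))%:E)%E.
  apply: eq_esum => d _; rewrite esumZl ?mulr_ge0 ?mass_ge0 //; last first.
    by move=> d'; rewrite mulr_ge0 ?mass_ge0.
  by rewrite -garble2E -EFinM; congr EFin; rewrite [RHS]mulrC [X in _ = _ * X]mulrC mulrA.
rewrite esum_exchange; last by move=> *; rewrite lee_fin !mulr_ge0 ?mass_ge0.
apply: eq_esum => d' _.
transitivity (\esum_(d in [set: nat])
  (s c i * u (k, c, d') * (q d' d * t d j))%:E)%E.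
  by apply: eq_esum => d _; congr EFin; ring.
rewrite esumZl ?mulr_ge0 ?mass_ge0 //; last first.
  by move=> d; rewrite mulr_ge0 ?mass_ge0.
by rewrite -bind_massE -EFinM; congr EFin; rewrite [s c i * _]mulrC.
Qed.

(** Playing s on a garbled signal amounts to first garbling one's own signal,
    and then playing s. *)
Lemma expected_payoff_garble1 q u s t :
  expected_payoff (garbled1 q u) s t =
  expected_payoff u ((fun c => dbind (q c) s) : strategy1 g) t.
Proof. by do 3 apply: eq_bigr => ? _; rewrite play_prob_garble1. Qed.

Lemma expected_payoff_garble2 q u s t :
  expected_payoff (garbled2 u q) s t =
  expected_payoff u s ((fun d => dbind (q d) t) : strategy2 g).
Proof. by do 3 apply: eq_bigr => ? _; rewrite play_prob_garble2. Qed.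

End FixedGame.
End Payoffs.

(** * Values of Bayesian games *)

Section Value.
Context (R : realType) (K : finType).
Implicit Types (u v : info_structure R K) (g : payoff R K).

Lemma strategy1_inh g : [set: strategy1 g] !=set0.
Proof.
by have /card_gt0P[a _] := act1_gt0 g; exists (fun=> dirac_distr R a).
Qed.

Lemma strategy2_inh g : [set: strategy2 g] !=set0.
Proof.
by have /card_gt0P[a _] := act2_gt0 g; exists (fun=> dirac_distr R a).
Qed.

Lemma inf_payoff_le u g (s : strategy1 g) (t : strategy2 g) :
  inf [set expected_payoff u s t | t in [set: strategy2 g]] <=
  expected_payoff u s t.
Proof.
apply: ge_inf; last by exists t.
exists (-1) => _ [t' _ <-]; by case/andP: (expected_payoff_bound u s t').
Qed.

Lemma sup_payoff_ge u g (s : strategy1 g) (t : strategy2 g) :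
  expected_payoff u s t <=
  sup [set expected_payoff u s t | s in [set: strategy1 g]].
Proof.
apply: ub_le_sup; last by exists s.
exists 1 => _ [s' _ <-]; by case/andP: (expected_payoff_bound u s' t).
Qed.

Definition lower_value u g : R :=
  sup [set inf [set expected_payoff u s t | t in [set: strategy2 g]]
      | s in [set: strategy1 g]].

Definition upper_value u g : R :=
  inf [set sup [set expected_payoff u s t | s in [set: strategy1 g]]
      | t in [set: strategy2 g]].

Lemma lower_value_has_sup u g :
  has_sup [set inf [set expected_payoff u s t | t in [set: strategy2 g]]
          | s in [set: strategy1 g]].
Proof.
split; first by have [s _] := strategy1_inh g; eexists; exists s.
exists 1 => _ [s _ <-]; have [t _] := strategy2_inh g.
apply: le_trans (inf_payoff_le u s t) _.
by case/andP: (expected_payoff_bound u s t).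
Qed.

Lemma upper_value_has_inf u g :
  has_inf [set sup [set expected_payoff u s t | s in [set: strategy1 g]]
          | t in [set: strategy2 g]].
Proof.
split; first by have [t _] := strategy2_inh g; eexists; exists t.
exists (-1) => _ [t _ <-]; have [s _] := strategy1_inh g.
apply: le_trans (sup_payoff_ge u s t).
by case/andP: (expected_payoff_bound u s t).
Qed.

Lemma lower_value_ge u g (s : strategy1 g) x :
  (forall t, x <= expected_payoff u s t) -> x <= lower_value u g.
Proof.
move=> xs; apply: (@le_trans _ _
  (inf [set expected_payoff u s t | t in [set: strategy2 g]])).
  apply: lb_le_inf; last by move=> _ [t _ <-].
  by have [t _] := strategy2_inh g; eexists; exists t.
by apply: ub_le_sup; [case: (lower_value_has_sup u g) | exists s].
Qed.

Lemma upper_value_le u g (t : strategy2 g) x :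
  (forall s, expected_payoff u s t <= x) -> upper_value u g <= x.
Proof.
move=> xt; apply: (@le_trans _ _
  (sup [set expected_payoff u s t | s in [set: strategy1 g]])).
  by apply: ge_inf; [case: (upper_value_has_inf u g) | exists t].
apply: ge_sup; last by move=> _ [s _ <-].
by have [s _] := strategy1_inh g; eexists; exists s.
Qed.

Lemma lower_le_upper_value u g : lower_value u g <= upper_value u g.
Proof.
apply: ge_sup; first by case: (lower_value_has_sup u g).
move=> _ [s _ <-]; apply: lb_le_inf; first by case: (upper_value_has_inf u g).
move=> _ [t _ <-]; apply: le_trans (inf_payoff_le u s t) _.
exact: sup_payoff_ge.
Qed.

(** Coefficients of the expected payoff as a bilinear form in the two
    behavioural strategies. *)
Definition strategy_form n u g : 'I_n -> act1 g -> 'I_n -> act2 g -> R :=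
  fun c i d j => \sum_k u (k, nat_of_ord c, nat_of_ord d) * g k i j.

Lemma play_prob_bounded n u g (s : strategy1 g) (t : strategy2 g) k i j :
  info_bounded (Some n) u ->
  play_prob u s t k i j =
  \sum_(c < n) \sum_(d < n)
    u (k, nat_of_ord c, nat_of_ord d) * s c i * t d j.
Proof.
move=> un; apply/EFin_inj; rewrite play_probE.
rewrite (esum_finite_support (h := fun y : 'I_n * 'I_n =>
  (nat_of_ord y.1, nat_of_ord y.2))).
- by rewrite sumEFin pair_bigA.
- by move=> [c d] [c' d'] /= [/ord_inj -> /ord_inj ->].
- by move=> y; rewrite lee_fin !mulr_ge0 ?mass_ge0.
- move=> [c d] cd /=; rewrite (info_bounded_out _ un) ?mul0r //.
  rewrite (leqNgt n c) (leqNgt n d) -negb_and; apply/negP => /andP[cn dn].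
  exact: (cd (Ordinal cn, Ordinal dn)).
Qed.

Lemma expected_payoff_bilin n u g (s : strategy1 g) (t : strategy2 g) :
  info_bounded (Some n) u ->
  expected_payoff u s t =
  bilin (strategy_form (n := n) u (g := g)) (fun c => s c) (fun d => t d).
Proof.
move=> un; rewrite /expected_payoff /bilin /strategy_form.
under eq_bigr => k _ do under eq_bigr => i _ do under eq_bigr => j _ do
  rewrite (play_prob_bounded s t k i j un).
transitivity (\sum_k \sum_i \sum_j \sum_(c < n) \sum_(d < n)
  s c i * t d j * (u (k, nat_of_ord c, nat_of_ord d) * g k i j)).
  apply: eq_bigr => k _; apply: eq_bigr => i _; apply: eq_bigr => j _.
  rewrite mulr_suml; apply: eq_bigr => c _.
  by rewrite mulr_suml; apply: eq_bigr => d _; ring.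
under [RHS]eq_bigr => c _ do under eq_bigr => i _ do
  under eq_bigr => d _ do under eq_bigr => j _ do rewrite mulr_sumr.
pose F k i j (c d : 'I_n) := s (nat_of_ord c) i * t (nat_of_ord d) j *
  (u (k, nat_of_ord c, nat_of_ord d) * g k i j).
transitivity (\sum_(p : K * act1 g * act2 g * 'I_n * 'I_n)
   F p.1.1.1.1 p.1.1.1.2 p.1.1.2 p.1.2 p.2).
  by rewrite !pair_bigA.
rewrite !pair_bigA /=.
by rewrite (reindex (fun p : 'I_n * act1 g * 'I_n * act2 g * K =>
   (p.2, p.1.1.1.2, p.1.2, p.1.1.1.1, p.1.1.2))) //=; exists
   (fun p => (p.1.2, p.1.1.1.2, p.2, p.1.1.2, p.1.1.1.1)) => -[[[[? ?] ?] ?] ?].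
Qed.

Definition strategy_of_stochastic (I : finType) n (s : 'I_n.+1 -> I -> R)
    (ks : stochastic s) : nat -> distr R I :=
  fun c => fin_distr (ks.1 (inord c)) (ks.2 (inord c)).

Lemma stochastic_strategy (I : finType) n (s : nat -> distr R I) :
  stochastic (fun c : 'I_n => mass (s c)).
Proof. by split=> [c i|c]; [exact: mass_ge0 | exact: sum_mass]. Qed.

Lemma saddle_bounded n u g : info_bounded (Some n.+1) u ->
  exists (s : strategy1 g) (t : strategy2 g) V,
    (forall t', V <= expected_payoff u s t') /\
    (forall s', expected_payoff u s' t <= V).
Proof.
move=> un.
have /card_gt0P[i0 _] := act1_gt0 g; have /card_gt0P[j0 _] := act2_gt0 g.
have [s [t [V [ks kt sV tV]]]] :=
  saddle_point (strategy_form (n := n.+1) u (g := g)) ord0 i0 ord0 j0.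
exists (strategy_of_stochastic ks), (strategy_of_stochastic kt), V; split.
  move=> t'; rewrite (expected_payoff_bilin _ _ un).
  rewrite (_ : (fun c => _) = s); first exact/tV/stochastic_strategy.
  by apply/funext => c; apply/funext => i; rewrite /= inord_val.
move=> s'; rewrite (expected_payoff_bilin _ _ un).
rewrite [X in bilin _ _ X](_ : _ = t); first exact/sV/stochastic_strategy.
by apply/funext => c; apply/funext => i; rewrite /= inord_val.
Qed.

Lemma state_of u : exists k : K, True.
Proof.
apply: contrapT => nk; have := mass_sum1 u; rewrite esum1 => [[] /eqP|].
  by rewrite eq_sym oner_eq0.
by move=> [[k c] d] _; exfalso; apply: nk; exists k.
Qed.

(** A pair of strategies that is optimal for a truncation of u is nearly optimal
    for u. *)
Lemma lower_eq_upper_value u g : lower_value u g = upper_value u g.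
Proof.
apply/eqP; rewrite eq_le lower_le_upper_value /=.
have [k0 _] := state_of u.
apply/ler_addgt0Pr => e e0.
have [|n [u' [un ue]]] := truncate_close u k0 (_ : 0 < e / 2); first by lra.
have [s [t [V [sV tV]]]] := saddle_bounded g un.
have l : V - e / 2 <= lower_value u g.
  apply: (@lower_value_ge _ _ s) => t'.
  have := expected_payoff_dist u' u s t'; rewrite l1distC.
  by have := sV t' => h1 h2; lra.
have h : upper_value u g <= V + e / 2.
  apply: (@upper_value_le _ _ t) => s'.
  have := expected_payoff_dist u u' s' t.
  by have := tV s' => h1 h2; lra.
by lra.
Qed.

Lemma game_valueE u g : game_value u g = lower_value u g.
Proof.
have h : is_value u g (lower_value u g).
  by split => //; exact: lower_eq_upper_value.
have [+ _] := @xgetPex _ 0 [set x | is_value u g x] (ex_intro _ _ h).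
by [].
Qed.

Lemma game_value_ge u g (s : strategy1 g) x :
  (forall t, x <= expected_payoff u s t) -> x <= game_value u g.
Proof. by rewrite game_valueE; exact: lower_value_ge. Qed.

Lemma game_value_le u g (t : strategy2 g) x :
  (forall s, expected_payoff u s t <= x) -> game_value u g <= x.
Proof. by rewrite game_valueE lower_eq_upper_value; exact: upper_value_le. Qed.

Lemma game_value_bound u g : -1 <= game_value u g <= 1.
Proof.
have [s _] := strategy1_inh g; have [t _] := strategy2_inh g.
apply/andP; split.
  by apply: (game_value_ge (s := s)) => t';
    case/andP: (expected_payoff_bound u s t').
by apply: (game_value_le (t := t)) => s';
  case/andP: (expected_payoff_bound u s' t).
Qed.

(** The way in which all comparisons of values are proved: player 1 converts his
    strategies from u to v while player 2 converts his own from v to u. *)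
Lemma game_value_simulation u v g (e : R) :
  (forall s : strategy1 g, exists s' : strategy1 g, forall t', exists t,
     expected_payoff u s t <= expected_payoff v s' t' + e) ->
  game_value u g <= game_value v g + e.
Proof.
move=> sim; apply/ler_addgt0Pr => d d0.
have [_ [s _ <-] sd] := sup_adherent d0 (lower_value_has_sup u g).
have [s' s's] := sim s.
rewrite -addrA -lerBlDr; apply: (game_value_ge (s := s')) => t'.
have [t st] := s's t'.
have := inf_payoff_le u s t; move: sd; rewrite -/(lower_value u g) -game_valueE.
by lra.
Qed.

Lemma game_value_dist u v g : game_value u g <= game_value v g + l1dist u v.
Proof.
apply: game_value_simulation => s; exists s => t; exists t.
exact: expected_payoff_dist.
Qed.

(** A strategy s of player 1 in v is played in u after garbling by q1, and a
    strategy t of player 2 in u is played in v after garbling by q2; the two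
    expected payoffs are those of (s, t) in v.q2 and in q1.u. *)
Lemma game_value_gap_le u v g (q1 q2 : garbling R) :
  game_value v g - game_value u g <= l1dist (garble1 q1 u) (garble2 v q2).
Proof.
rewrite lerBlDl; apply: game_value_simulation => s.
exists (fun c => dbind (q1 c) s) => t; exists (fun d => dbind (q2 d) t).
rewrite -expected_payoff_garble2 -expected_payoff_garble1.
have := expected_payoff_dist (garbled2 v q2) (garbled1 q1 u) s t.
by rewrite l1distC.
Qed.

End Value.

(** * Duality with finitely many signals *)

Section Duality.
Context (R : realType) (K : finType).
Implicit Types (u v : info_structure R K) (q : garbling R).

Lemma garble1_bounded n u q k c d : info_bounded (Some n) u ->
  garble1 q u (k, c, d) = \sum_(c' < n) u (k, nat_of_ord c', d) * q c' c.
Proof.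
move=> un; apply/EFin_inj; rewrite garble1E (esum_ord (n := n)) // => c'.
  by rewrite mulr_ge0 ?mass_ge0.
by move=> nc; rewrite (info_bounded_out _ un) ?mul0r // nc.
Qed.

Lemma garble2_bounded n u q k c d : info_bounded (Some n) u ->
  garble2 u q (k, c, d) = \sum_(d' < n) u (k, c, nat_of_ord d') * q d' d.
Proof.
move=> un; apply/EFin_inj; rewrite garble2E (esum_ord (n := n)) // => d'.
  by rewrite mulr_ge0 ?mass_ge0.
by move=> nd; rewrite (info_bounded_out _ un) ?mul0r // nd orbT.
Qed.

Section FiniteSignals.
Context (n : nat).
Let l := n.+1.

Lemma embed_mass_sum1 (p : 'I_l -> R) : (forall i, 0 <= p i) ->
  \sum_i p i = 1 ->
  (\esum_(c in [set: nat]) (if (c < l)%N then p (inord c) else 0)%:E = 1%:E)%E.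
Proof.
move=> p0 p1; rewrite (esum_ord (n := l)).
- rewrite -[in RHS]p1; congr EFin; apply: eq_bigr => c _.
  by rewrite ltn_ord inord_val.
- by move=> c; case: ifP.
- by move=> c; rewrite leqNgt => /negbTE ->.
Qed.

Lemma embed_mass_ge0 (p : 'I_l -> R) : (forall i, 0 <= p i) ->
  forall c, 0 <= if (c < l)%N then p (inord c) else 0.
Proof. by move=> p0 c; case: ifP. Qed.

(** Outside its range [inord] is 0: the signals that are at least l, of
    probability zero, are garbled in the same way as the signal 0. *)
Definition embed_garbling (t : 'I_l -> 'I_l -> R) (kt : stochastic t) : garbling R :=
  fun c => Distr (embed_mass_ge0 (kt.1 (inord c)))
                 (embed_mass_sum1 (kt.1 (inord c)) (kt.2 (inord c))).

Lemma embed_garblingE (t : 'I_l -> 'I_l -> R) (kt : stochastic t) (c c' : 'I_l) :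
  embed_garbling kt c' c = t c' c.
Proof. by rewrite /= ltn_ord !inord_val. Qed.

Lemma embed_garbling_bounded (t : 'I_l -> 'I_l -> R) (kt : stochastic t) :
  garbling_bounded (Some l) (embed_garbling kt).
Proof.
by move=> c; apply: almost_surely_inP => c' /= /negP /negbTE ->.
Qed.

Context (u v : info_structure R K).
Hypotheses (ul : info_bounded (Some l) u) (vl : info_bounded (Some l) v).

Let X := (K * 'I_l * 'I_l)%type.

Definition gap_entry (t1 t2 : 'I_l -> 'I_l -> R) (x : X) : R :=
  \sum_(d' < l) v (x.1.1, nat_of_ord x.1.2, nat_of_ord d') * t2 d' x.2 -
  \sum_(c' < l) u (x.1.1, nat_of_ord c', nat_of_ord x.2) * t1 c' x.1.2.

(** The chooser of the payoff g picks a sign b for each triple x.  The minimizer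
    has two kinds of information sets, the signals [inl c'] that q1 garbles and
    the signals [inr d'] that q2 garbles. *)
Definition gap_form (x : X) (b : bool) (y : 'I_l + 'I_l) (j : 'I_l) : R :=
  (-1) ^+ b * match y with
  | inl c' => - (u (x.1.1, nat_of_ord c', nat_of_ord x.2) * (j == x.1.2)%:R)
  | inr d' => v (x.1.1, nat_of_ord x.1.2, nat_of_ord d') * (j == x.2)%:R
  end.

(** The value of the form is <g, v.q2 - q1.u>, where g is the expected sign. *)
Lemma bilin_gap_form s t :
  bilin gap_form s t = \sum_x (s x false - s x true) *
    gap_entry (fun c' => t (inl c')) (fun d' => t (inr d')) x.
Proof.
rewrite bilinE2; apply: eq_bigr => x _.
suff E b : \sum_y \sum_j t y j * gap_form x b y j = (-1) ^+ b *
    gap_entry (fun c' => t (inl c')) (fun d' => t (inr d')) x.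
  by rewrite big_bool !E /= expr0 expr1; ring.
have pull (f : 'I_l -> R) (a e : R) j0 :
    \sum_j f j * (e * (a * (j == j0)%:R)) = e * (a * f j0).
  rewrite -(sum_pure j0 (fun j => e * (a * f j))).
  by apply: eq_bigr => j _; ring.
rewrite big_sumType /= /gap_entry mulrBr addrC !mulr_sumr -sumrN.
congr (_ + _); apply: eq_bigr => y _; first exact: pull.
rewrite -mulrN -mulNr -(pull (t (inl y))); apply: eq_bigr => j _; rewrite /gap_form; ring.
Qed.

Lemma l1dist_gap_entry (t1 t2 : 'I_l -> 'I_l -> R) (k1 : stochastic t1) (k2 : stochastic t2) :
  l1dist (garble1 (embed_garbling k1) u) (garble2 v (embed_garbling k2)) =
  \sum_x `|gap_entry t1 t2 x|.
Proof.
apply/EFin_inj.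
rewrite (l1distE (garbled1 (embed_garbling k1) u) (garbled2 v (embed_garbling k2))).
rewrite (@esum_box _ _ l) //; last first.
  move=> [[k c] d] /= h; apply: contrapT => /not_andP cd; apply: h.
  have {}cd : (l <= c)%N || (l <= d)%N.
    by rewrite (leqNgt l c) (leqNgt l d) -negb_and; apply/negP => /andP[] ; case: cd.
  rewrite -[_ - _]/(garble1 (embed_garbling k1) u (k, c, d) -
             garble2 v (embed_garbling k2) (k, c, d)).
  rewrite (garble1_bounded _ _ _ _ ul) (garble2_bounded _ _ _ _ vl).
  rewrite !big1 ?subrr ?normr0 // => i _ /=.
    case/orP: cd => h; first by rewrite (info_bounded_out _ vl) ?h ?mul0r.
    by rewrite ltnNge h mulr0.
  case/orP: cd => h; first by rewrite ltnNge h mulr0.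
  by rewrite (info_bounded_out _ ul) ?h ?orbT ?mul0r.
rewrite !pair_bigA; congr EFin; apply: eq_bigr => -[[k c] d] _.
rewrite -[_ - _]/(garble1 (embed_garbling k1) u (k, nat_of_ord c, nat_of_ord d) -
             garble2 v (embed_garbling k2) (k, nat_of_ord c, nat_of_ord d)).
rewrite (garble1_bounded _ _ _ _ ul) (garble2_bounded _ _ _ _ vl) distrC.
congr `|_ - _|; apply: eq_bigr => i _; by rewrite embed_garblingE.
Qed.

Section OptimalGame.
Context (s : X -> bool -> R) (ks : stochastic s).

Lemma saddle_payoff_bounded k (c d : 'I_l) :
  -1 <= s (k, c, d) false - s (k, c, d) true <= 1.
Proof.
have := ks.2 (k, c, d); rewrite big_bool /=.
have := ks.1 (k, c, d) false; have := ks.1 (k, c, d) true => ? ? ?.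
by apply/andP; split; lra.
Qed.

Let card_gt0 : (0 < #|'I_l|)%N. Proof. by rewrite card_ord. Qed.

Definition saddle_payoff : payoff R K :=
  Payoff card_gt0 card_gt0 saddle_payoff_bounded.

(** Actions are signals, and the player announces his own. *)
Definition truthful : nat -> distr R 'I_l := fun c => dirac_distr R (inord c).

Lemma truthful1_payoff (t : strategy2 saddle_payoff) :
  expected_payoff v (truthful : strategy1 saddle_payoff) t =
  \sum_x (s x false - s x true) *
    \sum_(d' < l) v (x.1.1, nat_of_ord x.1.2, nat_of_ord d') *
                  t (nat_of_ord d') x.2.
Proof.
rewrite /expected_payoff !pair_bigA; apply: eq_bigr => -[[k c] d] _.
rewrite mulrC; congr (_ * _); rewrite (play_prob_bounded _ _ _ _ _ vl).
rewrite exchange_big; apply: eq_bigr => d' _ /=.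
rewrite (bigD1 c) //= inord_val eqxx mulr1 big1 ?addr0 // => i /negbTE ic.
by rewrite inord_val eq_sym ic mulr0 mul0r.
Qed.

Lemma truthful2_payoff (t : strategy1 saddle_payoff) :
  expected_payoff u t (truthful : strategy2 saddle_payoff) =
  \sum_x (s x false - s x true) *
    \sum_(c' < l) u (x.1.1, nat_of_ord c', nat_of_ord x.2) *
                  t (nat_of_ord c') x.1.2.
Proof.
rewrite /expected_payoff !pair_bigA; apply: eq_bigr => -[[k c] d] _.
rewrite mulrC; congr (_ * _); rewrite (play_prob_bounded _ _ _ _ _ ul).
apply: eq_bigr => c' _ /=.
rewrite (bigD1 d) //= inord_val eqxx mulr1 big1 ?addr0 // => i /negbTE ic.
by rewrite inord_val eq_sym ic mulr0.
Qed.

(** If player 1 is truthful in v and player 2 is truthful in u, the difference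
    of the two payoffs is the bilinear form at the strategies of the other two
    players, seen as garblings. *)
Lemma saddle_payoff_gap (V : R) :
  (forall t, stochastic t -> V <= bilin gap_form s t) ->
  V <= game_value v saddle_payoff - game_value u saddle_payoff.
Proof.
move=> sV.
have h (s' : strategy1 saddle_payoff) (t' : strategy2 saddle_payoff) :
    V + expected_payoff u s' (truthful : strategy2 saddle_payoff) <=
    expected_payoff v (truthful : strategy1 saddle_payoff) t'.
  rewrite truthful1_payoff truthful2_payoff -lerBrDr -sumrB.
  pose t (y : 'I_l + 'I_l) j :=
    match y with inl c' => s' (nat_of_ord c') j | inr d' => t' (nat_of_ord d') j end.
  have kt : stochastic t.
    by split=> [[y|y] j|[y|y]] /=; rewrite ?mass_ge0 ?sum_mass.
  apply: le_trans (sV t kt) _; rewrite bilin_gap_form.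
  by apply: ler_sum => x _; rewrite -mulrBr.
rewrite lerBrDr.
rewrite addrC -lerBrDr.
apply: (@game_value_le _ _ _ saddle_payoff truthful) => s'; rewrite lerBrDl.
exact: (@game_value_ge _ _ _ saddle_payoff truthful).
Qed.

End OptimalGame.

(** The saddle point of [gap_form]: its payoff side gives g by
    [saddle_payoff_gap]; testing its garbling side against the pointwise sign of
    v.q2 - q1.u gives the norm. *)
Lemma finite_duality : exists (g : payoff R K) q1 q2,
  [/\ payoff_bounded l g, garbling_bounded (Some l) q1,
      garbling_bounded (Some l) q2 &
      l1dist (garble1 q1 u) (garble2 v q2) <= game_value v g - game_value u g].
Proof.
have [k0 _] := state_of u.
have [s [t [V [ks kt sV tV]]]] :=
  saddle_point gap_form (k0, ord0, ord0) true (inl ord0) ord0.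
pose t1 c' := t (inl c'); pose t2 d' := t (inr d').
have k1 : stochastic t1 by split=> [y j|y]; [exact: kt.1 | exact: kt.2].
have k2 : stochastic t2 by split=> [y j|y]; [exact: kt.1 | exact: kt.2].
exists (saddle_payoff ks), (embed_garbling k1), (embed_garbling k2); split.
- by split; rewrite card_ord.
- exact: embed_garbling_bounded.
- exact: embed_garbling_bounded.
apply: le_trans (saddle_payoff_gap ks tV).
pose sg x b : R := (b == (gap_entry t1 t2 x < 0))%:R.
have ksg : stochastic sg.
  split=> [x b|x]; first exact: ler0n.
  by rewrite big_bool /sg; case: (_ < 0); rewrite /= ?addr0 ?add0r.
apply: le_trans (sV sg ksg); rewrite l1dist_gap_entry bilin_gap_form.
apply: ler_sum => x _; rewrite /sg -/t1 -/t2.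
case: (ltP (gap_entry t1 t2 x) 0) => h /=.
  by rewrite ltr0_norm // sub0r mulN1r.
by rewrite ger0_norm // subr0 mul1r.
Qed.

End FiniteSignals.
End Duality.

(** * Limits of garblings *)

Section Contraction.
Context (R : realType) (K : finType).
Implicit Types (u v : info_structure R K) (q : garbling R).

Lemma l1dist_garble1 q u v :
  l1dist (garbled1 q u) (garbled1 q v) <= l1dist u v.
Proof.
rewrite -lee_fin (l1distE u v) (l1distE (garbled1 q u) (garbled1 q v)).
rewrite -(esum_garble1 q (fun x => normr_ge0 (u x - v x))).
apply: le_esum => -[[k c] d] _.
have q0 (w : K * nat * nat -> R) c' : (forall x, 0 <= w x) ->
  (0 <= (w (k, c', d) * q c' c)%:E)%E.
  by move=> w0; rewrite lee_fin mulr_ge0 ?mass_ge0.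
have h (u1 u2 : info_structure R K) :
    ((garble1 q u1 (k, c, d))%:E <= (garble1 q u2 (k, c, d))%:E +
     (\esum_(c' in [set: nat]) (`|u1 (k, c', d) - u2 (k, c', d)| * q c' c)%:E))%E.
  rewrite !garble1E -esumD; last 2 first.
  - by move=> *; apply: q0; exact: mass_ge0.
  - by move=> c' _; rewrite lee_fin mulr_ge0 ?mass_ge0.
  apply: le_esum => c' _; rewrite -EFinD lee_fin -mulrDl ler_wpM2r ?mass_ge0 //.
  by rewrite -lerBlDl ler_norm.
have := h u v; have := h v u; under eq_esum do rewrite distrC.
rewrite -[(_ <= \esum_(_ in _) _)%E]/(`|garble1 q u (k, c, d) - garble1 q v (k, c, d)|%:E <=
  \esum_(c' in [set: nat]) (`|u (k, c', d) - v (k, c', d)| * q c' c)%:E)%E.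
move: (garble1 q u (k, c, d)) (garble1 q v (k, c, d)) => x y.
case: esum => [r| |]; rewrite -?EFinD ?lee_fin ?leey //.
by rewrite ler_distl => h1 h2; apply/andP; split; lra.
Qed.

Lemma l1dist_garble2 q u v :
  l1dist (garbled2 u q) (garbled2 v q) <= l1dist u v.
Proof.
rewrite -lee_fin (l1distE u v) (l1distE (garbled2 u q) (garbled2 v q)).
rewrite -(esum_garble2 q (fun x => normr_ge0 (u x - v x))).
apply: le_esum => -[[k c] d] _.
have q0 (w : K * nat * nat -> R) d' : (forall x, 0 <= w x) ->
  (0 <= (w (k, c, d') * q d' d)%:E)%E.
  by move=> w0; rewrite lee_fin mulr_ge0 ?mass_ge0.
have h (u1 u2 : info_structure R K) :
    ((garble2 u1 q (k, c, d))%:E <= (garble2 u2 q (k, c, d))%:E +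
     (\esum_(d' in [set: nat]) (`|u1 (k, c, d') - u2 (k, c, d')| * q d' d)%:E))%E.
  rewrite !garble2E -esumD; last 2 first.
  - by move=> *; apply: q0; exact: mass_ge0.
  - by move=> d' _; rewrite lee_fin mulr_ge0 ?mass_ge0.
  apply: le_esum => d' _; rewrite -EFinD lee_fin -mulrDl ler_wpM2r ?mass_ge0 //.
  by rewrite -lerBlDl ler_norm.
have := h u v; have := h v u; under eq_esum do rewrite distrC.
rewrite -[(_ <= \esum_(_ in _) _)%E]/(`|garble2 u q (k, c, d) - garble2 v q (k, c, d)|%:E <=
  \esum_(d' in [set: nat]) (`|u (k, c, d') - v (k, c, d')| * q d' d)%:E)%E.
move: (garble2 u q (k, c, d)) (garble2 v q (k, c, d)) => x y.
case: esum => [r| |]; rewrite -?EFinD ?lee_fin ?leey //.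
by rewrite ler_distl => h1 h2; apply/andP; split; lra.
Qed.

Lemma l1dist_garbles q1 q2 u u' v v' :
  l1dist (garbled1 q1 u) (garbled2 v q2) <=
  l1dist (garbled1 q1 u') (garbled2 v' q2) + l1dist u u' + l1dist v v'.
Proof.
have h1 := l1dist_triangle (garbled1 q1 u') (garbled1 q1 u) (garbled2 v q2).
have h2 := l1dist_triangle (garbled2 v' q2) (garbled1 q1 u') (garbled2 v q2).
have h3 := l1dist_garble1 q1 u u'.
have h4 := l1dist_garble2 q2 v' v; rewrite (l1distC v' v) in h4.
by lra.
Qed.

(* overlap *)
(** The common mass of q1.u and v.q2 when u and v have signals below n.  The
    arguments a1 and a2 are arbitrary arrays, so that limits of garblings, which
    may have lost mass, are covered. *)
Definition overlap n u v (a1 a2 : nat -> nat -> R) : R :=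
  \sum_k \sum_(c < n) \sum_(d < n) Num.min
    (\sum_(c' < n) u (k, nat_of_ord c', nat_of_ord d) * a1 c' c)
    (\sum_(d' < n) v (k, nat_of_ord c, nat_of_ord d') * a2 d' d).

(** q1.u charges only signals d < n and v.q2 only signals c < n, so that their
    minimum is supported in the box. *)
Lemma l1dist_garbles_overlap n u v q1 q2 :
  info_bounded (Some n) u -> info_bounded (Some n) v ->
  l1dist (garbled1 q1 u) (garbled2 v q2) =
  2 - 2 * overlap n u v (fun c => q1 c) (fun d => q2 d).
Proof.
move=> un vn; have := l1dist_overlap (garbled1 q1 u) (garbled2 v q2).
rewrite (@esum_box _ _ n); first last.
- move=> [[k c] d] h; apply: contrapT => /= /not_andP cd; apply: h.
  rewrite -[LHS]/(Num.min (garble1 q1 u (k, c, d)) (garble2 v q2 (k, c, d))).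
  have [nd|nc] : (n <= d)%N \/ (n <= c)%N.
    by case: cd => /negP; rewrite -leqNgt; [right|left].
  + rewrite (garble1_bounded _ _ _ _ un) big1; last first.
      by move=> i _; rewrite (info_bounded_out _ un) ?nd ?orbT ?mul0r.
    by apply/min_idPl; exact: garble2_ge0.
  + rewrite (garble2_bounded _ _ _ _ vn) big1; last first.
      by move=> i _; rewrite (info_bounded_out _ vn) ?nc ?mul0r.
    by apply/min_idPr; exact: garble1_ge0.
- by move=> x; rewrite le_min !mass_ge0.
rewrite -EFinM -EFinD => -[] /esym/eqP; rewrite -subr_eq => /eqP <-.
congr (_ - 2 * _); apply: eq_bigr => k _; apply: eq_bigr => c _.
apply: eq_bigr => d _.
by rewrite -(garble1_bounded _ _ _ _ un) -(garble2_bounded _ _ _ _ vn).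
Qed.

Lemma le_overlap n u v (a1 a2 b1 b2 : nat -> nat -> R) :
  (forall c' c, a1 c' c <= b1 c' c) -> (forall d' d, a2 d' d <= b2 d' d) ->
  overlap n u v a1 a2 <= overlap n u v b1 b2.
Proof.
move=> ab1 ab2; do 3 (apply: ler_sum => ? _).
apply: le_min2; apply: ler_sum => i _; exact: ler_wpM2l (mass_ge0 _ _) _ _ _.
Qed.

End Contraction.

Section Limit.
Context (R : realType).

Lemma cvg_fin_sum (T : Type) (F : set_system T) (FF : Filter F) (I : finType)
    (f : I -> T -> R) (l : I -> R) :
  (forall i, f i x @[x --> F] --> l i) ->
  \sum_i f i x @[x --> F] --> \sum_i l i.
Proof.
move=> fl; elim: (index_enum I) => [|i r IH].
  by rewrite big_nil; under eq_fun do rewrite big_nil; exact: cvg_cst.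
by rewrite big_cons; under eq_fun do rewrite big_cons; apply: cvgD.
Qed.

Lemma cvg_minr (T : Type) (F : set_system T) (FF : Filter F) (f g : T -> R) (a b : R) :
  f x @[x --> F] --> a -> g x @[x --> F] --> b ->
  Num.min (f x) (g x) @[x --> F] --> Num.min a b.
Proof.
move=> fa gb; rewrite minr_absE; under eq_fun do rewrite minr_absE.
by apply: cvgMl; apply: cvgB; [exact: cvgD | apply: cvg_norm; exact: cvgB].
Qed.

(** Along an ultrafilter, a cluster point is a limit; using an ultrafilter makes
    all entries of the garblings converge at once. *)
Lemma ultra_cvg (T : Type) (U : set_system T) (UU : UltraFilter U) (x : T -> R) :
  (forall t, 0 <= x t <= 1) -> exists a : R, x t @[t --> U] --> a.
Proof.
move=> x01.
have xU : U (x @^-1` [set` `[0, 1]%R]).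
  by apply: filterE => t; rewrite /= in_itv /=; exact: x01.
have [a [_ ca]] := @segment_compact R 0 1 (x t @[t --> U]) _ xU.
exists a => B Ba; have [//|UB] := in_ultra_setVsetC (x @^-1` B) UU.
by have [y [/= yB By]] := ca (~` B) B UB Ba.
Qed.

Section Complete.
Context (p : nat -> R) (p0 : forall c, 0 <= p c)
  (p1 : forall n, \sum_(c < n) p c <= 1).

Let mE : ((fine (\esum_(c in [set: nat]) (p c)%:E))%:E =
  \esum_(c in [set: nat]) (p c)%:E)%E /\
  (\esum_(c in [set: nat]) (p c)%:E <= 1%:E)%E.
Proof.
have h : (\esum_(c in [set: nat]) (p c)%:E <= 1%:E)%E.
  rewrite -nneseries_esumT //.
  have p0E c : true -> (0 <= (p c)%:E)%E by rewrite lee_fin.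
  apply: (lime_le (is_cvg_nneseries_cond (fun n _ => p0E n))).
  by apply: nearW => n; rewrite sumEFin lee_fin big_mkord.
split => //; apply: fineK; rewrite ge0_fin_numE.
  by apply: le_lt_trans h _; rewrite ltry.
by apply: esum_ge0 => c _; rewrite lee_fin.
Qed.

Let m := fine (\esum_(c in [set: nat]) (p c)%:E).

Let m1 : 0 <= 1 - m.
Proof. by case: mE => e; rewrite -e lee_fin subr_ge0. Qed.

Let completion_mass c := p c + (1 - m) * dirac_distr R 0%N c.

Let completion_ge0 c : 0 <= completion_mass c.
Proof. by rewrite addr_ge0 ?mulr_ge0 ?mass_ge0. Qed.

Let completion_sum1 :
  (\esum_(c in [set: nat]) (completion_mass c)%:E = 1%:E)%E.
Proof.
under eq_esum do rewrite EFinD.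
rewrite esumD; last 2 first.
- by move=> c _; rewrite lee_fin.
- by move=> c _; rewrite lee_fin mulr_ge0 ?mass_ge0.
rewrite -mE.1 esumZl // mass_sum1 mule1 -EFinD addrC subrK //.
Qed.

(** Here the missing mass is put at 0; by [le_overlap] its location does
    not matter for what follows. *)
Lemma completion : exists p' : distr R nat, forall c, p c <= p' c.
Proof.
exists (Distr completion_ge0 completion_sum1) => c.
by rewrite lerDl mulr_ge0 ?mass_ge0.
Qed.

End Complete.

Lemma ultra_garbling (U : set_system nat) (UU : UltraFilter U)
    (q : nat -> garbling R) :
  exists (a : nat -> nat -> R) (q' : garbling R),
    (forall c' c, q n c' c @[n --> U] --> a c' c) /\
    (forall c' c, a c' c <= q' c' c).
Proof.
have /choice[a aP] : forall cc : nat * nat, exists a : R,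
    q n cc.1 cc.2 @[n --> U] --> a.
  by move=> cc; apply: ultra_cvg => n; rewrite mass_ge0 mass_le1.
have a0 cc : 0 <= a cc.
  apply: (cvgr_to_ge (aP cc)); apply: nearW => n; exact: mass_ge0.
have a1 c' n : \sum_(c < n) a (c', nat_of_ord c) <= 1.
  apply: (cvgr_to_le (@cvg_fin_sum _ U _ _ (fun (c : 'I_n) i => q i c' c) _ _)).
    by move=> c; exact: (aP (c', nat_of_ord c)).
  apply: nearW => i; rewrite -lee_fin -(mass_sum1 (q i c')) -sumEFin.
  apply: esum_ge; exists [set nat_of_ord c | c in [set: 'I_n]].
    by split => //; exact/finite_image/finite_finset.
  rewrite fsbig_image //=; last by move=> x y _ _ /ord_inj.
  rewrite (fsbigE (enum 'I_n)) ?enum_uniq //; last first.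
    by move=> x _; rewrite mem_enum.
  rewrite big_enum_cond; rewrite le_eqVlt; apply/orP; left; apply/eqP.
  by apply: eq_bigl => x; rewrite inE; apply/esym/asboolP.
have /choice[q' q'P] : forall c', exists p : distr R nat,
    forall c, a (c', c) <= p c.
  by move=> c'; apply: completion.
by exists (fun c' c => a (c', c)), q'; split => // c' c; exact: (aP (c', c)).
Qed.

Lemma cvg_overlap (K : finType) (U : set_system nat) (FU : Filter U) n
    (u v : info_structure R K) (q1 q2 : nat -> garbling R) a1 a2 :
  (forall c' c, q1 i c' c @[i --> U] --> (a1 c' c : R)) ->
  (forall c' c, q2 i c' c @[i --> U] --> (a2 c' c : R)) ->
  overlap n u v (fun c => q1 i c) (fun d => q2 i d) @[i --> U] -->
  overlap n u v a1 a2.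
Proof.
move=> h1 h2; do 3 (apply: cvg_fin_sum => ?).
by apply: cvg_minr; apply: cvg_fin_sum => i; apply: cvgMr.
Qed.

(** The norm is lower semicontinuous in the garblings even when mass escapes to
    infinity: up to a truncation of u and v it is 2 - 2 [overlap], which is
    continuous and which the completion of the limits can only decrease. *)
Lemma garbling_limit (K : finType) (u v : info_structure R K) (m : R) :
  (forall e, 0 < e -> exists q1 q2 : garbling R,
     l1dist (garble1 q1 u) (garble2 v q2) <= m + e) ->
  exists q1 q2 : garbling R, l1dist (garble1 q1 u) (garble2 v q2) <= m.
Proof.
move=> approx; have [k0 _] := state_of u.
have /choice[q1] : forall n : nat, exists q1, exists q2 : garbling R,
    l1dist (garble1 q1 u) (garble2 v q2) <= m + n.+1%:R^-1.
  by move=> n; apply: approx; rewrite invr_gt0.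
move=> /choice[q2 q12].
have [U [UU Uoo]] := ultraFilterLemma (@eventually_filter).
have [a1 [p1 [qa1 ap1]]] := ultra_garbling UU q1.
have [a2 [p2 [qa2 ap2]]] := ultra_garbling UU q2.
exists p1, p2; apply/ler_addgt0Pr => e e0.
(* four times e / 5 for the two truncations, done and undone, and once for the
   distance of l1dist to m along the sequence *)
have e5 : 0 < e / 5 by lra.
have [nu [u' [un uu']]] := truncate_close u k0 e5.
have [nv [v' [vn vv']]] := truncate_close v k0 e5.
pose n := maxn nu.+1 nv.+1.
have {}un := info_boundedW (leq_maxl nu.+1 nv.+1 : (_ <= n)%N) un.
have {}vn := info_boundedW (leq_maxr nu.+1 nv.+1 : (_ <= n)%N) vn.
have lim : 2 - 2 * overlap n u' v' a1 a2 <= m + 3 * (e / 5).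
  have cv : 2 - 2 * overlap n u' v' (fun c => q1 i c) (fun d => q2 i d) @[i --> U]
      --> 2 - 2 * overlap n u' v' a1 a2.
    by apply: cvgB; [exact: cvg_cst | apply: cvgMr; exact: cvg_overlap].
  apply: (cvgr_to_le cv); apply: Uoo; near=> i.
  rewrite -l1dist_garbles_overlap //.
  have h := l1dist_garbles (q1 i) (q2 i) u' u v' v.
  rewrite (l1distC u' u) (l1distC v' v) in h.
  have hi : l1dist (garbled1 (q1 i) u) (garbled2 v (q2 i)) <= m + e / 5.
    apply: le_trans (q12 i) _; rewrite lerD2l.
    by near: i; apply: (cvgr_le 0 (@cvg_harmonic R)).
  by lra.
have := l1dist_garbles p1 p2 u u' v v'.
rewrite (l1dist_garbles_overlap p1 p2 un vn).
have := le_overlap n u' v' ap1 ap2.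
rewrite -[l1dist (garble1 _ _) _]/(l1dist (garbled1 p1 u) (garbled2 v p2)).
by lra.
Unshelve. all: by end_near.
Qed.

End Limit.

(** * The supremum of the value gaps *)

Section Gap.
Context (R : realType) (K : finType).
Implicit Types (u v : info_structure R K) (q : garbling R).

Lemma payoff_inh : exists g : payoff R K, True.
Proof.
have unit_gt0 : (0 < #|{: unit}|)%N by rewrite card_unit.
have b (k : K) (i j : unit) : -1 <= (0 : R) <= 1 by rewrite lerN10 ler01.
by exists (Payoff unit_gt0 unit_gt0 b).
Qed.

Lemma gap_has_sup v u :
  has_sup [set x | exists g : payoff R K, x = game_value v g - game_value u g].
Proof.
have [g _] := payoff_inh.
split; first by exists (game_value v g - game_value u g), g.
exists 2 => _ [h ->].
move: (game_value_bound v h) (game_value_bound u h).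
by move: (game_value v h) (game_value u h) => x y /andP[? ?] /andP[? ?]; lra.
Qed.

Lemma gap_le_sup_gap v u (g : payoff R K) :
  game_value v g - game_value u g <= sup_gap v u.
Proof. by apply: (sup_upper_bound (gap_has_sup v u)); exists g. Qed.

Lemma sup_gap_le_l1dist v u q1 q2 :
  sup_gap v u <= l1dist (garble1 q1 u) (garble2 v q2).
Proof.
apply: ge_sup; first by case: (gap_has_sup v u).
by move=> _ [g ->]; exact: game_value_gap_le.
Qed.

Lemma garbling_unbounded q : garbling_bounded None q.
Proof. by move=> c; apply: almost_surely_inP => x []. Qed.

(** With infinitely many signals, the finite duality for truncations at e / 4
    of u and v is off by at most e: each truncation is counted once in the
    values and once in the norm. *)
Lemma sup_gap_attained (L : option nat) (L_ge1 : forall l, L = Some l -> (1 <= l)%N)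
    u v : info_bounded L u -> info_bounded L v ->
  exists q1 q2, [/\ garbling_bounded L q1, garbling_bounded L q2 &
    l1dist (garble1 q1 u) (garble2 v q2) = sup_gap v u].
Proof.
case: L L_ge1 => [[|n]|] L_ge1 uL vL; first by have := L_ge1 0%N erefl.
  have [g [q1 [q2 [_ q1L q2L le_gap]]]] := finite_duality uL vL.
  exists q1, q2; split => //; apply/eqP.
  by rewrite eq_le sup_gap_le_l1dist (le_trans le_gap) // gap_le_sup_gap.
have [|q1 [q2 q12]] := @garbling_limit _ _ u v (sup_gap v u).
  move=> e e0; have [k0 _] := state_of u.
  have e4 : 0 < e / 4 by lra.
  have [nu [u' [un uu']]] := truncate_close u k0 e4.
  have [nv [v' [vn vv']]] := truncate_close v k0 e4.
  have {}un := info_boundedW (leq_maxl nu.+1 nv.+1) un.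
  have {}vn := info_boundedW (leq_maxr nu.+1 nv.+1) vn.
  move: un vn; rewrite maxnSS => un vn.
  have [g [q1 [q2 [_ _ _ le_gap]]]] := finite_duality un vn.
  exists q1, q2.
  have h := l1dist_garbles q1 q2 u u' v v'.
  have hv := game_value_dist v' v g; rewrite (l1distC v' v) in hv.
  have hu := game_value_dist u u' g.
  have hg := gap_le_sup_gap v u g.
  apply: le_trans h _; move: le_gap hv hu hg uu' vv'.
  rewrite -[l1dist (garble1 _ _) _]/(l1dist (garbled1 q1 u') (garbled2 v' q2)).
  move: (l1dist (garbled1 _ _) _) (l1dist u u') (l1dist v v') (sup_gap v u).
  move: (game_value v g) (game_value u g) (game_value v' g) (game_value u' g).
  by move=> *; lra.
exists q1, q2; split; try exact: garbling_unbounded.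
by apply/eqP; rewrite eq_le sup_gap_le_l1dist q12.
Qed.

Lemma value_dist_max u v : value_dist u v = Num.max (sup_gap v u) (sup_gap u v).
Proof.
apply/eqP; rewrite eq_le; apply/andP; split.
  apply: ge_sup.
    by have [g _] := payoff_inh; exists `|game_value u g - game_value v g|, g.
  move=> _ [g ->]; rewrite ler_norml; apply/andP; split.
    by rewrite lerNl opprB le_max; apply/orP; left; exact: gap_le_sup_gap.
  by rewrite le_max; apply/orP; right; exact: gap_le_sup_gap.
have ub : has_ubound [set x | exists g : payoff R K,
    x = `|game_value u g - game_value v g|].
  exists 2 => _ [g ->]; rewrite ler_norml.
  move: (game_value_bound v g) (game_value_bound u g).
  move: (game_value v g) (game_value u g) => x y /andP[? ?] /andP[? ?].
  by apply/andP; split; lra.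
rewrite ge_max; apply/andP; split.
  apply: ge_sup => [|_ [g ->]]; first by case: (gap_has_sup v u).
  apply: le_trans (ler_norm _) _; rewrite distrC.
  by apply: ub_le_sup => //; exists g.
apply: ge_sup => [|_ [g ->]]; first by case: (gap_has_sup u v).
apply: le_trans (ler_norm _) _.
by apply: ub_le_sup => //; exists g.
Qed.

End Gap.

Theorem theorem1 (R : realType) (K : finType) (K_ge2 : (2 <= #|K|)%N)
    (L : option nat) (L_ge1 : forall l, L = Some l -> (1 <= l)%N)
    (u v : info_structure R K)
    (uL : info_bounded L u) (vL : info_bounded L v) :
  [/\ is_min [set l1dist (garble1 q1 u) (garble2 v q2)
             | q1 in garbling_bounded (R := R) L & q2 in garbling_bounded L]
        (sup_gap v u),
      exists m1 m2 : R,
        [/\ is_min [set l1dist (garble1 q1 u) (garble2 v q2)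
                   | q1 in garbling_bounded (R := R) L
                   & q2 in garbling_bounded L] m1,
            is_min [set l1dist (garble2 u q1) (garble1 q2 v)
                   | q1 in garbling_bounded (R := R) L
                   & q2 in garbling_bounded L] m2
          & value_dist u v = Num.max m1 m2]
    & forall l : nat, L = Some l ->
        exists g : payoff R K,
          payoff_bounded l g /\ game_value v g - game_value u g = sup_gap v u].
Proof.
have min1 (u' v' : info_structure R K) :
    info_bounded L u' -> info_bounded L v' ->
    is_min [set l1dist (garble1 q1 u') (garble2 v' q2)
           | q1 in garbling_bounded (R := R) L & q2 in garbling_bounded L]
      (sup_gap v' u').
  move=> uL' vL'; have [q1 [q2 [q1L q2L q12]]] := sup_gap_attained L_ge1 uL' vL'.
  split; first by exists q1 => //; exists q2.
  by move=> _ [p1 _ [p2 _ <-]]; exact: sup_gap_le_l1dist.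
split; first exact: min1.
  exists (sup_gap v u), (sup_gap u v); split; [exact: min1 | | exact: value_dist_max].
  have swap q1 q2 : l1dist (garble2 u q1) (garble1 q2 v) =
                    l1dist (garble1 q2 v) (garble2 u q1).
    exact: (l1distC (garbled2 u q1) (garbled1 q2 v)).
  have [[q1 q1L [q2 q2L q12]] lb] := min1 v u vL uL.
  split.
    exact: (ex_intro2 _ _ q2 q2L
      (ex_intro2 _ _ q1 q1L (etrans (swap q2 q1) q12))).
  move=> _ [p1 p1L [p2 p2L <-]]; rewrite swap.
  by apply: lb; exists p2 => //; exists p1.
move=> [|n] Ll; first by have := L_ge1 _ Ll.
rewrite Ll in uL vL; have [g [q1 [q2 [gl _ _ le_gap]]]] := finite_duality uL vL.
exists g; split => //; apply/eqP; rewrite eq_le (gap_le_sup_gap v u g).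
exact: le_trans (sup_gap_le_l1dist _ _ _ _) le_gap.
Qed.
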